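(* Let $m,n$ be positive integers, $T=\{(i,j)\mid 1\le i\le m,\ 1\le j\le n\}$, let $K$ be a field, and let $S\subseteq T$. Let $R_S$ be the semigroup ring (a $K$-subalgebra of $K[u_1,\dots,u_m,v_1,\dots,v_n,w,t]$) generated by the monomials $u_iv_jw$ for $(i,j)\in S$ and $u_iv_jt$ for $(i,j)\in T\setminus S$. Let $K[X]=K[\{x_{i,j}\}_{(i,j)\in T}]$ and let $\pi:K[X]\to R_S$ be the surjective $K$-algebra homomorphism with $\pi(x_{i,j})=u_iv_jw$ if $(i,j)\in S$ and $\pi(x_{i,j})=u_iv_jt$ if $(i,j)\notin S$, and let $I_S=\ker\pi$. Then the following conditions are equivalent: (i) $I_S$ is generated by quadratic binomials; (ii) $I_S$ possesses a squarefree initial ideal (with respect to some monomial order); (iii) $I_S$ possesses a quadratic Gröbner basis (with respect to some monomial order); (iv) $R_S$ is normal; (v) $R_S$ is Koszul; (vi) $S$ is either $2\times 2$ block diagonal or triangular.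
   Context: $I_S$ is called the toric ideal of two way subtable sum problems associated with $S$. A subset $S\subseteq T$ is called $2\times2$ block diagonal if, after an appropriate permutation of the rows (first coordinates) and of the columns (second coordinates), there exist integers $r,c$ such that $S=\{(i,j)\mid 1\le i\le r,\ 1\le j\le c\}\cup\{(i,j)\mid r<i\le m,\ c<j\le n\}$. A subset $S\subseteq T$ is called triangular if, after an appropriate permutation of the rows and of the columns, $S$ satisfies: whenever $(i,j)\in S$, then $(i',j')\in S$ for all $1\le i'\le i$ and $1\le j'\le j$. *)

(* Defs.v *)
From HB Require Import structures.
From mathcomp Require Import all_boot all_order all_algebra all_fingroup.
From mathcomp Require Import mpoly.
Set Implicit Arguments. Unset Strict Implicit. Unset Printing Implicit Defensive.
Import Order.TTheory GRing.Theory.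
Local Open Scope ring_scope.

Section Defs.
Variable K : fieldType.

Definition ideal_gen (N : nat) (G : {mpoly K[N]} -> Prop) (p : {mpoly K[N]}) : Prop :=
  exists s : seq ({mpoly K[N]} * {mpoly K[N]}),
    (forall q, q \in s -> G q.2) /\ p = \sum_(q <- s) q.1 * q.2.

Definition same_set (N : nat) (A B : {mpoly K[N]} -> Prop) : Prop :=
  forall p, A p <-> B p.

(* A monomial order on the monomials 'X_{1..N}: a strict total order,
   compatible with multiplication of monomials, and with 1 = 'X_[0] minimal
   (hence a well-order, by Dickson's lemma). *)
Definition monomial_order (N : nat) (lt : rel 'X_{1..N}) : Prop :=
  [/\ irreflexive lt, transitive lt,
      (forall a b, a != b -> lt a b || lt b a),
      (forall a b c, lt a b -> lt (a + c)%MM (b + c)%MM) &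
      (forall a, a != 0%MM -> lt 0%MM a)].

Definition is_initial_mon (N : nat) (lt : rel 'X_{1..N}) (p : {mpoly K[N]})
    (m : 'X_{1..N}) : Prop :=
  m \in msupp p /\ (forall m', m' \in msupp p -> m' != m -> lt m' m).

Definition initial_monomials (N : nat) (lt : rel 'X_{1..N})
    (G : {mpoly K[N]} -> Prop) (q : {mpoly K[N]}) : Prop :=
  exists p m, G p /\ p != 0 /\ is_initial_mon lt p m /\ q = 'X_[m].

Definition initial_ideal (N : nat) (lt : rel 'X_{1..N}) (I : {mpoly K[N]} -> Prop) :=
  ideal_gen (initial_monomials lt I).

Definition squarefree_mon (N : nat) (m : 'X_{1..N}) : bool :=
  [forall i, m i <= 1]%N.

(* Ambient ring K[u_1..u_m, v_1..v_n, w, t] = {mpoly K[(m+n).+2]}, with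
   (0-based) u_i = 'X_i, v_j = 'X_(m+j), w = 'X_(m+n), t = 'X_(m+n+1). *)
Definition amb (m n : nat) := {mpoly K[(m + n).+2]}.

Definition gen_S (m n : nat) (S : {set 'I_m * 'I_n}) (i j : nat) : amb m n :=
  'X_(inord i) * 'X_(inord (m + j)) *
  (if [exists c in S, ((c.1 : nat) == i) && ((c.2 : nat) == j)]
   then 'X_(inord (m + n)) else 'X_(inord (m + n).+1)).

(* K[X] = {mpoly K[m*n]}, the variable x_{i,j} being 'X_k with k = i*n + j. *)
Definition gens_S (m n : nat) (S : {set 'I_m * 'I_n}) : (m * n).-tuple (amb m n) :=
  [tuple gen_S S (k %/ n) (k %% n) | k < m * n].

Definition pi_S (m n : nat) (S : {set 'I_m * 'I_n}) (p : {mpoly K[m * n]}) : amb m n :=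
  p \mPo gens_S S.

Definition I_S (m n : nat) (S : {set 'I_m * 'I_n}) (p : {mpoly K[m * n]}) : Prop :=
  pi_S S p = 0.

Definition R_S (m n : nat) (S : {set 'I_m * 'I_n}) (f : amb m n) : Prop :=
  exists p, f = pi_S S p.

(* Degree-one part (R_S)_1 = K-span of the generators, and the irrelevant
   ideal (R_S)_+ (grading: each generator has degree 1). *)
Definition R_S1 (m n : nat) (S : {set 'I_m * 'I_n}) (f : amb m n) : Prop :=
  exists p : {mpoly K[m * n]}, p \is 1.-homog /\ f = pi_S S p.

Definition R_Splus (m n : nat) (S : {set 'I_m * 'I_n}) (f : amb m n) : Prop :=
  exists p : {mpoly K[m * n]}, p@_0%MM = 0 /\ f = pi_S S p.

Definition quadratic_binomial (N : nat) (g : {mpoly K[N]}) : Prop :=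
  exists a b : 'X_{1..N}, mdeg a = 2%N /\ mdeg b = 2%N /\ a != b /\ g = 'X_[a] - 'X_[b].

Definition gen_by_quadratic_binomials (N : nat) (I : {mpoly K[N]} -> Prop) : Prop :=
  exists G : {mpoly K[N]} -> Prop,
    (forall g, G g -> quadratic_binomial g /\ I g) /\ same_set (ideal_gen G) I.

Definition has_squarefree_initial_ideal (N : nat) (I : {mpoly K[N]} -> Prop) : Prop :=
  exists lt : rel 'X_{1..N}, monomial_order lt /\
    exists M : 'X_{1..N} -> Prop, (forall a, M a -> squarefree_mon a) /\
      same_set (initial_ideal lt I) (ideal_gen (fun q => exists a, M a /\ q = 'X_[a])).

Definition has_quadratic_groebner_basis (N : nat) (I : {mpoly K[N]} -> Prop) : Prop :=
  exists lt : rel 'X_{1..N}, monomial_order lt /\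
    exists G : {mpoly K[N]} -> Prop,
      (forall g, G g -> [/\ I g, g != 0 & g \is 2.-homog]) /\
      same_set (initial_ideal lt I) (ideal_gen (initial_monomials lt G)).

(* (iv) R is normal: R (a domain) is integrally closed in its field of
   fractions, i.e. whenever f/g (f, g in R, g <> 0) satisfies a monic
   equation over R, then f/g lies in R. *)
Definition normal_subring (N : nat) (R : {mpoly K[N]} -> Prop) : Prop :=
  forall f g, R f -> R g -> g != 0 ->
    (exists (d : nat) (a : nat -> {mpoly K[N]}), (0 < d)%N /\
       (forall k, R (a k)) /\
       f ^+ d + \sum_(1 <= k < d.+1) a k * f ^+ (d - k) * g ^+ k = 0) ->
    exists h, R h /\ f = g * h.

(* (v) R is Koszul: the residue field K = R / R_+ has a linear graded free
   resolution  ... -> R^(b 1) -> R^(b 0) -> R -> K -> 0 over R, i.e.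
   all differentials are matrices with entries in R_1 and the complex is
   exact. (Elements of free modules are row vectors, maps act on the right.) *)
Definition koszul_ring (N : nat) (R R1 Rplus : {mpoly K[N]} -> Prop) : Prop :=
  exists (b : nat -> nat) (d0 : 'M[{mpoly K[N]}]_(b 0%N, 1))
         (d : forall k, 'M[{mpoly K[N]}]_(b k.+1, b k)),
    (forall i j, R1 (d0 i j)) /\ (forall k i j, R1 (d k i j)) /\
    (forall f, Rplus f <->
       exists x : 'rV_(b 0%N), (forall i, R (x 0 i)) /\ f = (x *m d0) 0 0) /\
    (forall x : 'rV_(b 0%N), (forall i, R (x 0 i)) ->
       (x *m d0 = 0 <-> exists y : 'rV_(b 1%N), (forall i, R (y 0 i)) /\ x = y *m d 0%N)) /\
    (forall k (x : 'rV_(b k.+1)), (forall i, R (x 0 i)) ->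
       (x *m d k = 0 <-> exists y : 'rV_(b k.+2), (forall i, R (y 0 i)) /\ x = y *m d k.+1)).

End Defs.

Definition block_diagonal_2x2 (m n : nat) (S : {set 'I_m * 'I_n}) : Prop :=
  exists (s : 'S_m) (s' : 'S_n) (r c : nat),
    forall i j, ((i, j) \in S) <->
      (((s i < r)%N /\ (s' j < c)%N) \/ ((r <= s i)%N /\ (c <= s' j)%N)).

Definition triangular (m n : nat) (S : {set 'I_m * 'I_n}) : Prop :=
  exists (s : 'S_m) (s' : 'S_n),
    forall i j i' j', (i, j) \in S -> (s i' <= s i)%N -> (s' j' <= s' j)%N ->
      (i', j') \in S.

(* Main.v *)
Require Import Defs.
From HB Require Import structures.
From mathcomp Require Import all_boot all_order all_algebra all_fingroup.
From mathcomp Require Import mpoly.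
From mathcomp Require Import zify ring.
From Stdlib Require Import ClassicalEpsilon.

(* If S is triangular, place rows and columns as distinct points on a circle so that the
   cell (i, j) becomes the arc from i clockwise to j and the cells of S are the arcs through
   the base point.  Two monomials have the same image under pi iff they have the same margins
   and the same total arc length, so replacing a pair of nested arcs by the two overlapping
   arcs with the same end points is a binomial of I_S; it decreases the sum of the squared
   lengths, and a monomial without nested arcs is determined by its image.  Hence the squarefree
   quadrics given by nested pairs generate the initial ideal.  The exponents occurring in R_S are
   cut out by the inequalities 0 <= #(arcs through z) <= #(arcs), which gives normality by
   comparing leading monomials in c f^n = g^n h.  Koszulness is Schreyer's construction over
   K[X] / I: when the initial ideal is quadratic, the syzygies of a family of linear vectors
   whose leading terms are variables again have such a Groebner basis.  A block diagonal S has
   the same ideal I_S as its off-diagonal block, which is triangular.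

   In all other cases, up to transposition and complement of S, there are rows 1, 2 and columns
   1, 2, 3 meeting S in (1,1) and (2,2) only.  Then x11 x12 x23^2 - x21 x22 x13^2 lies in I_S,
   while every proper divisor of either monomial is alone in its fibre; this excludes quadratic
   generation, squarefree and quadratic initial ideals and Koszulness, and
   x11 x12 x23 / x13 has its square in R_S but is not in R_S. *)

Set Implicit Arguments. Unset Strict Implicit. Unset Printing Implicit Defensive.
Import Order.TTheory GRing.Theory.
Local Open Scope ring_scope.

(** The six conditions are not deduced from one another: a dichotomy on [S] proves all of them or
    refutes all of them. Both halves see only the kernel of pi, hence only which monomials share a
    fibre; this is why transposition, complement and the passage from a block diagonal [S] to its
    off-diagonal block reduce to comparing margins. The weight is the squared length because the
    total length is constant on fibres, while a strictly convex function of the length drops at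
    every exchange. Koszulness asks for an explicit infinite resolution over R, so the induction
    must carry a property that reproduces itself: leading terms that are variables times basis
    vectors, modulo an ideal with quadratic leading terms. In the negative direction the first two
    matrices of a linear resolution suffice, since they write an element of I through quadrics of I
    and products of elements of I with polynomials without constant term. *)

Local Ltac mnm_lia :=
  apply/mnmP => ?; rewrite ?(mnmDE, mnmBE, mnm1E, mnm0E); lia.

(** * Monomial orders *)

Lemma max_exists (T : eqType) (r : rel T) (s : seq T) :
  transitive r -> (forall x y, x != y -> r x y || r y x) -> s != [::] ->
  exists2 x, x \in s & forall y, y \in s -> y != x -> r y x.
Proof.
move=> tr tot; elim: s => // x s IH _.
have [->|sn0] := eqVneq s [::].
  by exists x; rewrite ?mem_head // => y; rewrite inE => ->.
have [z zs zmax] := IH sn0.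
have [xz|xz] := eqVneq x z.
  exists z; first by rewrite inE zs orbT.
  by move=> y; rewrite inE => /orP[/eqP->|/zmax//]; rewrite xz eqxx.
have /orP[rxz|rzx] := tot _ _ xz.
  exists z; first by rewrite inE zs orbT.
  by move=> y; rewrite inE => /orP[/eqP->//|/zmax].
exists x; first by rewrite mem_head.
move=> y; rewrite inE => /orP[/eqP->|ys _]; first by rewrite eqxx.
by have [->//|/(zmax _ ys)] := eqVneq y z; move/tr; apply.
Qed.

Section MonomialOrder.
Local Open Scope ring_scope.
Variables (K : fieldType) (N : nat) (lt : rel 'X_{1..N}).
Hypothesis ltO : monomial_order lt.

Lemma mo_irr a : lt a a = false. Proof. by case: ltO => /(_ a). Qed.
Lemma mo_tr : transitive lt. Proof. by case: ltO. Qed.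
Lemma mo_tot a b : a != b -> lt a b || lt b a. Proof. by case: ltO => _ _ h _ _; apply: h. Qed.
Lemma mo_add2r c a b : lt (a + c)%MM (b + c)%MM = lt a b.
Proof.
case: ltO => irr tr tot add _; apply/idP/idP; last exact: add.
move=> h; have [ab|/tot/orP[//|/(add _ _ c) h']] := eqVneq a b.
  by rewrite ab irr in h.
by have := tr _ _ _ h h'; rewrite irr.
Qed.
Lemma mo_add2l c a b : lt (c + a)%MM (c + b)%MM = lt a b.
Proof. by rewrite !(addmC c) mo_add2r. Qed.

Lemma mo_lead (p : {mpoly K[N]}) : p != 0 -> exists m, is_initial_mon lt p m.
Proof.
rewrite -msupp_eq0 => pn0.
by have [m ms mmax] := max_exists mo_tr mo_tot pn0; exists m.
Qed.

Definition mole a b := (a == b) || lt a b.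

Lemma mole_refl a : mole a a. Proof. by rewrite /mole eqxx. Qed.
Lemma mole_add a b c d : mole a c -> mole b d -> mole (a + b)%MM (c + d)%MM.
Proof.
move=> /orP[/eqP<-|ac] /orP[/eqP<-|bd]; rewrite /mole ?eqxx //.
- by rewrite mo_add2l bd orbT.
- by rewrite mo_add2r ac orbT.
by rewrite (mo_tr (y := (c + b)%MM)) ?mo_add2r ?mo_add2l ?orbT.
Qed.
Lemma mole_add2r c a b : mole (a + c)%MM (b + c)%MM = mole a b.
Proof. by rewrite /mole mo_add2r (inj_eq (@addIm _ _)). Qed.
Lemma mole_anti a b : mole a b -> mole b a -> a = b.
Proof.
by move=> /orP[/eqP//|ab] /orP[/eqP//|/(mo_tr ab)]; rewrite mo_irr.
Qed.
Lemma mole_neq_lt a b : mole a b -> a != b -> lt a b.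
Proof. by move=> /orP[->|]. Qed.
(** A sum of two comparisons can be tight only if each of them is; [syz_lead_product] uses this to
    isolate the one product that reaches the leading monomial. *)
Lemma mole_add_eq a b c d : mole a c -> mole b d -> (a + b = c + d)%MM -> a = c /\ b = d.
Proof.
move=> ac bd e; have ca : mole c a.
  apply/negPn/negP => nca; have lac : lt a c.
    by apply: mole_neq_lt => //; apply: contra nca => /eqP->; apply: mole_refl.
  have := mole_add (mole_refl c) bd; rewrite -e /mole mo_add2r.
  have -> : lt c a = false by apply/negP => /(mo_tr lac); rewrite mo_irr.
  rewrite orbF => /eqP/addIm ca; by rewrite ca mo_irr in lac.
have ac' := mole_anti ac ca; split=> //.
by move: e; rewrite ac' !(addmC c) => /addIm.
Qed.

End MonomialOrder.

(** * Koszulness from a quadratic initial ideal *)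

Lemma mcoeffM_neq0 (R : nzRingType) n (p q : {mpoly R[n]}) m : (p * q)%R@_m != 0%R ->
  exists a c, [/\ m = (a + c)%MM, p@_a != 0%R & q@_c != 0%R].
Proof.
rewrite -mcoeff_msupp => /msuppM_le/allpairsP[[a c] /= [ap cq ->]].
by exists a, c; rewrite -!mcoeff_msupp.
Qed.

Lemma mcoeffXM (R : comNzRingType) n (p : {mpoly R[n]}) m a :
  ('X_[m] * p)%R@_(m + a)%MM = p@_a.
Proof. by rewrite mulrC mcoeffMX. Qed.

Lemma mcoeffXM_neq0 (R : comNzRingType) n (p : {mpoly R[n]}) m c : ('X_[m] * p)%R@_c != 0%R ->
  exists2 a, c = (m + a)%MM & p@_a != 0%R.
Proof.
case/mcoeffM_neq0 => a [c' [-> + pc]].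
by rewrite mcoeffX; have [<- _|_ /eqP[]//] := eqVneq m a; exists c'.
Qed.

Lemma scale_delta_mxE (R : nzRingType) n (p : R) (j i : 'I_n) :
  (p *: delta_mx 0 j : 'rV_n) 0 i = if i == j then p else 0.
Proof. by rewrite !mxE eqxx /=; case: eqP; rewrite ?mulr1 ?mulr0. Qed.

(** * Syzygies of linear families modulo an ideal with quadratic leading terms *)

Section SchreyerStep.
Local Open Scope ring_scope.
Variables (K : fieldType) (N : nat) (lt : rel 'X_{1..N}).
Hypothesis ltO : monomial_order lt.
Local Notation P := {mpoly K[N]}.
Variable I : P -> Prop.
Hypothesis I_sub : forall p q : P, I p -> I q -> I (p - q).
Hypothesis I_mul : forall p q : P, I q -> I (p * q).
Hypothesis I0 : I 0.
Variable bad : rel 'I_N.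
Hypothesis bad_sym : forall x y, bad x y = bad y x.
Hypothesis bad_lead : forall x y, bad x y ->
  exists q, [/\ I q, q \is 2.-homog & is_initial_mon lt q (U_(x) + U_(y))%MM].
Hypothesis lead_bad : forall p m, I p -> is_initial_mon lt p m ->
  exists x y, bad x y /\ (U_(x) + U_(y) <= m)%MM.

Let I_add p q : I p -> I q -> I (p + q).
Proof.
move=> Ip Iq; rewrite -[q]opprK -[- q]sub0r.
by apply: I_sub => //; apply: I_sub.
Qed.

Section Terms.
Variables (b : nat) (w : 'I_b -> 'X_{1..N}) (rho : 'I_b -> nat).

(** The weight [w j] is the leading monomial that the basis vector [e_j] stands for, as in a
    Schreyer order; an injective [rho] breaks the remaining ties. *)
Definition tlt (s t : 'I_b * 'X_{1..N}) : bool :=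
  lt (s.2 + w s.1)%MM (t.2 + w t.1)%MM ||
  ((s.2 + w s.1)%MM == (t.2 + w t.1)%MM) && (rho s.1 < rho t.1)%N.

Lemma tlt_irr t : tlt t t = false.
Proof. by rewrite /tlt (mo_irr ltO) ltnn andbF. Qed.

Lemma tlt_tr : transitive tlt.
Proof.
move=> t s u /orP[st|/andP[/eqP st rst]] /orP[tu|/andP[/eqP tu rtu]]; rewrite /tlt.
- by rewrite (mo_tr ltO st tu).
- by rewrite -tu st.
- by rewrite st tu.
by rewrite st tu eqxx (ltn_trans rst rtu) orbT.
Qed.

Hypothesis rho_inj : injective rho.

Lemma tlt_tot s t : s != t -> tlt s t || tlt t s.
Proof.
case: s t => [i a] [j c] st; rewrite /tlt /=.
have [e|/(mo_tot ltO)/orP[->|->]] := eqVneq (a + w i)%MM (c + w j)%MM; rewrite ?orbT //.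
rewrite e !(mo_irr ltO) /=; case: ltngtP => // /rho_inj ij; subst j.
by move/addIm: e => e; rewrite e eqxx in st.
Qed.

Lemma tlt_mul m i a j c : tlt (i, m + a)%MM (j, m + c)%MM = tlt (i, a) (j, c).
Proof. by rewrite /tlt /= -!addmA (mo_add2l ltO) !(addmC m) (inj_eq (@addIm _ _)). Qed.

Definition tc (f : 'rV[P]_b) (t : 'I_b * 'X_{1..N}) : K := (f 0 t.1)@_t.2.

Lemma tcB f h t : tc (f - h) t = tc f t - tc h t.
Proof. by rewrite /tc !mxE mcoeffB. Qed.

Definition lead_term (f : 'rV[P]_b) t :=
  tc f t != 0 /\ forall s, tc f s != 0 -> s != t -> tlt s t.

Lemma lead_term_exists f : f != 0 -> exists t, lead_term f t.
Proof.
move=> fn0; pose s := flatten [seq [seq (j, m) | m <- msupp (f 0 j)] | j <- enum 'I_b].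
have mem_s t : (t \in s) = (tc f t != 0).
  apply/flattenP/idP => [[l /mapP[j _ ->] /mapP[m + ->]]|]; first by rewrite mcoeff_msupp.
  case: t => j m; rewrite /tc /= -mcoeff_msupp => mf.
  exists [seq (j, m) | m <- msupp (f 0 j)]; last by apply/mapP; exists m.
  by apply/mapP; exists j; rewrite ?mem_enum.
have [|t ts tmax] := @max_exists _ tlt s tlt_tr tlt_tot.
  apply: contra fn0 => /eqP s0; apply/eqP/rowP => j; rewrite mxE; apply/mpolyP => m.
  by rewrite mcoeff0; apply/eqP/negPn/negP; rewrite -[_@__]/(tc f (j, m)) -mem_s s0.
by exists t; split=> [|u]; rewrite -mem_s //; apply: tmax.
Qed.

(** Homogeneity is included so that cancelling with such a vector never leaves the degrees already
    present. *)
Definition monic_term (h : 'rV[P]_b) t :=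
  [/\ tc h t = 1, forall s, tc h s != 0 -> s != t -> tlt s t &
      forall s, tc h s != 0 -> mdeg s.2 = mdeg t.2].

Lemma monic_shift h t m : monic_term h t -> monic_term ('X_[m] *: h) (t.1, (m + t.2)%MM).
Proof.
case: t => i a [h1 hlt hdeg]; split=> [|[j c]|[j c]]; rewrite /tc !mxE /=.
- by rewrite mcoeffXM.
- case/mcoeffXM_neq0 => c' -> hc ne; rewrite tlt_mul; apply: hlt => //.
  by apply: contraNneq ne => -[-> ->].
by case/mcoeffXM_neq0 => c' -> hc; rewrite !mdegD -(hdeg (j, c')).
Qed.

Lemma cancel_lead f h t : (forall s, tc f s != 0 -> s != t -> tlt s t) -> monic_term h t ->
  forall s, tc (f - (tc f t)%:MP *: h) s != 0 ->
    tlt s t /\ (tc f s != 0 \/ tc h s != 0 /\ tc f t != 0).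
Proof.
move=> flt [h1 hlt _] s.
have -> : tc (f - (tc f t)%:MP *: h) s = tc f s - tc f t * tc h s.
  by rewrite /tc !mxE mcoeffB mcoeffCM.
have [-> /=|st] := eqVneq s t; first by rewrite h1 mulr1 subrr eqxx.
have [->|fs] := eqVneq (tc f s) 0; last by split; [apply: flt | left].
rewrite sub0r oppr_eq0 mulf_eq0 negb_or => /andP[ft hs].
by split; [apply: hlt | right].
Qed.

Lemma monic_of_bad j x z : bad x z ->
  exists2 h : 'rV[P]_b, (forall i, I (h 0 i)) & monic_term h (j, (U_(x) + U_(z))%MM).
Proof.
case/bad_lead => q [Iq /dhomogP qh [qm qmax]].
pose c := q@_(U_(x) + U_(z)); have cn0 : c != 0 by rewrite -mcoeff_msupp.
exists ((c^-1%:MP * q) *: delta_mx 0 j).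
  by move=> i; rewrite scale_delta_mxE; case: eqP => // _; apply: I_mul.
have tcE s : tc ((c^-1%:MP * q) *: delta_mx 0 j) s = if s.1 == j then c^-1 * q@_s.2 else 0.
  by rewrite /tc scale_delta_mxE; case: eqP; rewrite ?mcoeff0 ?mcoeffCM.
have nz s : tc ((c^-1%:MP * q) *: delta_mx 0 j) s != 0 -> s.1 = j /\ q@_s.2 != 0.
  by rewrite tcE; have [->|_ /eqP[]//] := eqVneq s.1 j; rewrite mulf_eq0 negb_or => /andP[].
split=> [|[i a] /nz /= [-> qa] ne|[i a] /nz /= [_ qa]].
- by rewrite tcE eqxx mulVf.
- rewrite /tlt /= (mo_add2r ltO) qmax ?mcoeff_msupp //.
  by apply: contraNneq ne => ->.
by rewrite (qh a) ?mcoeff_msupp // mdegD !mdeg1.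
Qed.

End Terms.

Section Division.
Variables (b : nat) (w : 'I_b -> 'X_{1..N}) (rho : 'I_b -> nat) (U : 'rV[P]_b -> Prop).
Variables (r : nat) (y : 'I_r -> 'I_N) (k : 'I_r -> 'I_b) (g : 'M[P]_(r, b)).

Local Notation tltb := (tlt w rho).

(* The rows of [g] are a Groebner basis of [U] modulo [I], with respect to the
   term order [tltb], and the leading terms are the [X_(y l) e_(k l)]. *)
Record linear_basis : Prop := LinearBasis {
  lb_rho : injective rho;
  lb_sub : forall f h, U f -> U h -> U (f - h);
  lb_mul : forall p f, U f -> U (p *: f);
  lb_I : forall f : 'rV_b, (forall j, I (f 0 j)) -> U f;
  lb_inj : injective (fun l => (y l, k l));
  lb_lin : forall l j, g l j \is 1.-homog;
  lb_lead : forall l, (g l (k l))@_U_(y l) = 1;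
  lb_lt : forall l j m, (g l j)@_m != 0 -> (j, m) != (k l, U_(y l)%MM) ->
    tltb (j, m) (k l, U_(y l)%MM);
  lb_U : forall l, U (row l g);
  lb_init : forall f t, U f -> lead_term w rho f t ->
    (exists x z, bad x z /\ (U_(x) + U_(z) <= t.2)%MM) \/
    exists2 l, k l = t.1 & (0 < t.2 (y l))%N }.

Hypothesis LB : linear_basis.

Lemma monic_basis l : monic_term w rho (row l g) (k l, U_(y l)%MM).
Proof.
split=> [|[j m]|[j m]]; rewrite /tc mxE /=.
- exact: lb_lead.
- exact: lb_lt.
by rewrite -mcoeff_msupp => /(dhomogP _ _ _ (lb_lin LB l j)) ->; rewrite mdeg1.
Qed.

Section Rank.
Variable D : nat.

(** Infinitely many terms may lie below a given one, so only those of degree at most [D] are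
    counted; this rank makes the division terminate. *)
Definition trank (t : 'I_b * 'X_{1..N}) :=
  #|[pred s : 'I_b * 'X_{1..N < D.+1} | tltb (s.1, bmnm s.2) t]|.

Lemma trank_lt s t : (mdeg s.2 <= D)%N -> tltb s t -> (trank s < trank t)%N.
Proof.
case: s => j m /= mD st; apply: proper_card; apply/properP; split.
  by apply/subsetP => u; rewrite !inE => /tlt_tr; apply.
have mD' : (mdeg m < D.+1)%N by [].
by exists (j, BMultinom mD'); rewrite !inE //= tlt_irr.
Qed.

(** [Q] and [L] record degrees and a down-set of terms that the reduction never leaves, so that the
    cofactors come with bounds. The successor in [(mdeg m).+1] accounts for the degree of the linear
    row that the cofactor multiplies. *)
Lemma division (Q : pred nat) (L : pred ('I_b * 'X_{1..N})) (f : 'rV[P]_b) :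
  (forall e, Q e -> (e <= D)%N) -> (forall s t, tltb s t -> L t -> L s) ->
  U f -> (forall t, tc f t != 0 -> Q (mdeg t.2) /\ L t) ->
  exists c : 'rV[P]_r,
    (forall l m, (c 0 l)@_m != 0 -> Q (mdeg m).+1 /\ L (k l, (U_(y l) + m)%MM)) /\
    forall j, I ((f - c *m g) 0 j).
Proof.
move=> QD Ldown.
have [n] : exists n, forall t, tc f t != 0 -> (trank t < n)%N.
  have [->|/(lead_term_exists w (lb_rho LB))[t [tn0 tmax]]] := eqVneq f 0.
    by exists 0%N => t; rewrite /tc mxE mcoeff0 eqxx.
  exists #|[pred s : 'I_b * 'X_{1..N < D.+1} | true]|.+1 => s _.
  by rewrite ltnS; apply: subset_leq_card; apply/subsetP.
elim: n f => [|n IH] f fn Uf fQ.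
  exists 0; split=> [l m|j]; first by rewrite mxE mcoeff0 eqxx.
  suff -> : f = 0 by rewrite mul0mx subr0 mxE.
  by apply/rowP => j'; rewrite mxE; apply/mpolyP => m; rewrite mcoeff0; apply/eqP/negPn/negP => /(fn (j', m)).
have [f0|/(lead_term_exists w (lb_rho LB))[t [tn0 tmax]]] := eqVneq f 0.
  exists 0; split=> [l m|j]; first by rewrite mxE mcoeff0 eqxx.
  by rewrite f0 mul0mx subr0 mxE.
have [Qt Lt] := fQ _ tn0.
have step h : U h -> monic_term w rho h t ->
    exists c : 'rV[P]_r,
    (forall l m, (c 0 l)@_m != 0 -> Q (mdeg m).+1 /\ L (k l, (U_(y l) + m)%MM)) /\
    forall j, I ((f - (tc f t)%:MP *: h - c *m g) 0 j).
  move=> Uh mh; have red := cancel_lead tmax mh.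
  have redQ s : tc (f - (tc f t)%:MP *: h) s != 0 -> Q (mdeg s.2).
    case/red => _ [/fQ[]//|[hs _]]; case: mh => _ _ ->//.
  apply: IH; last 1 first.
  - move=> s hs; split; first exact: redQ.
    by case/red: hs => st _; apply: Ldown Lt.
  - move=> s hs; have /red[st _] := hs.
    have := trank_lt (QD _ (redQ _ hs)) st; have := fn _ tn0; lia.
  by apply: (lb_sub LB) => //; apply: (lb_mul LB).
case: t tn0 tmax Qt Lt step => j0 m tn0 tmax Qt Lt step.
(* A leading term divisible by a bad pair is cancelled by a vector with entries in [I], which leaves
   the cofactors unchanged; otherwise a multiple of row [l] cancels it and is recorded in [c]. *)
case: (lb_init LB Uf (conj tn0 tmax)) => /= [[x [z [xz le]]]|[l kl yl]].
  have [h Ih /(monic_shift (m - (U_(x) + U_(z)))%MM)] := monic_of_bad w rho j0 xz.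
  rewrite /= submK // => mh.
  have IXh i : I (('X_[m - (U_(x) + U_(z))] *: h) 0 i) by rewrite mxE; apply: I_mul.
  have [|c [c1 c2]] := step _ _ mh; first exact: (lb_I LB).
  exists c; split=> // j; have := c2 j; set p := _ 0 j => Ip.
  have -> : (f - c *m g) 0 j = p + (tc f (j0, m))%:MP * ('X_[m - (U_(x) + U_(z))] *: h) 0 j.
    by rewrite /p !mxE; ring.
  by apply: I_add => //; apply: I_mul.
have lem : (U_(y l) <= m)%MM.
  by apply/mnm_lepP => i; rewrite mnm1E; case: eqP => // <-.
have /(monic_shift (m - U_(y l))%MM) := monic_basis l; rewrite /= submK // kl => mh.
have [|c [c1 c2]] := step _ _ mh; first by apply: (lb_mul LB); apply: (lb_U LB).
pose e : 'rV[P]_r := ((tc f (j0, m))%:MP * 'X_[m - U_(y l)]) *: delta_mx 0 l.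
exists (c + e); split=> [l' a|j]; last first.
  rewrite mulmxDl -scalemxAl -rowE; have := c2 j; congr I; rewrite !mxE; ring.
rewrite mxE mcoeffD; have [c0|/c1//] := eqVneq ((c 0 l')@_a) 0.
rewrite c0 add0r /e scale_delta_mxE; have [->|_] := eqVneq l' l; last by rewrite mcoeff0 eqxx.
rewrite mcoeffCM mcoeffX; have [<- _|_] := eqVneq (m - U_(y l))%MM a; last by rewrite mulr0 eqxx.
rewrite addmC submK // kl; split=> //.
by move: Qt; rewrite /= -{1}(submK lem) mdegD mdeg1 addn1.
Qed.
End Rank.

Definition syz (f : 'rV[P]_r) := forall j, I ((f *m g) 0 j).

(* Schreyer's order on the syzygies: ties are broken by the position of the leading
   term first, and by its variable second. *)
Definition next_w l : 'X_{1..N} := (U_(y l) + w (k l))%MM.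
Definition next_rho (l : 'I_r) : nat := (rho (k l) * N + y l)%N.
(** These [z] are the variables with [z * y i] in the initial ideal of [I] or divisible by the
    leading variable of an earlier row in the same position. The colon ideal by [y i] needs, beyond
    the bad pairs, only variables, because the initial ideal is quadratic. *)
Definition next_pair (z : 'I_N) (i : 'I_r) :=
  bad z (y i) || [exists l, [&& k l == k i, (y l < y i)%N & y l == z]].

Local Notation tltn := (tlt next_w next_rho).

Lemma next_rho_lt l i : (rho (k l) < rho (k i))%N -> (next_rho l < next_rho i)%N.
Proof. by rewrite /next_rho; have := ltn_ord (y l); nia. Qed.

Lemma tlt_next l m i z :
  tltb (k l, U_(y l) + m)%MM (k i, U_(z) + U_(y i))%MM -> tltn (l, m) (i, U_(z)%MM).
Proof.
rewrite /tlt /= /next_w.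
have -> : (m + (U_(y l) + w (k l)) = U_(y l) + m + w (k l))%MM by mnm_lia.
have -> : (U_(z) + (U_(y i) + w (k i)) = U_(z) + U_(y i) + w (k i))%MM by mnm_lia.
by case/orP => [->//|/andP[-> /next_rho_lt ->]]; rewrite orbT.
Qed.

(** An S-pair: [z] times row [i] and a second element of [U] share the leading term [t], and their
    difference divides with linear cofactors below [t]. The second element has entries in [I] if [z]
    and [y i] are bad, and is [y i] times row [l] if [z = y l]. *)
Lemma syz_with_lead z i : next_pair z i ->
  exists2 s : 'rV[P]_r, syz s & monic_term next_w next_rho s (i, U_(z)%MM).
Proof.
move=> zi; pose t := (k i, U_(z) + U_(y i))%MM.
have [h [e [Uh mh elt Ie]]] : exists h : 'rV[P]_b, exists e : 'rV[P]_r,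
    [/\ U h, monic_term w rho h t, forall s, tc e s != 0 ->
       tltn s (i, U_(z)%MM) /\ mdeg s.2 = 1%N & forall j, I ((h - e *m g) 0 j)].
  case/orP: zi => [/(monic_of_bad w rho (k i))[h Ih mh]|/existsP[l /and3P[/eqP kl yl /eqP zl]]].
    exists h, 0; split=> // [|s|j]; first exact: (lb_I LB).
      by rewrite /tc mxE mcoeff0 eqxx.
    by rewrite mul0mx subr0.
  have := monic_shift U_(y i)%MM (monic_basis l); rewrite /= zl kl addmC => mh.
  exists ('X_[U_(y i)] *: row l g), ('X_[U_(y i)] *: delta_mx 0 l).
  split=> // [||j]; first by apply: (lb_mul LB); apply: (lb_U LB).
    case=> l' a; rewrite /tc scale_delta_mxE /=; have [->|_] := eqVneq l' l; last by rewrite mcoeff0 eqxx.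
    rewrite mcoeffX; have [<- _|_ /eqP[]//] := eqVneq U_(y i)%MM a.
    split; last by rewrite mdeg1.
    (* The Schreyer weights tie here, so [y l < y i] decides through [next_rho]. *)
    rewrite /tlt /next_w /=; apply/orP; right; apply/andP; split.
      by apply/eqP; rewrite kl -zl; mnm_lia.
    by rewrite /next_rho kl ltn_add2l.
  by rewrite -scalemxAl -rowE subrr mxE.
have mh0 : monic_term w rho ('X_[U_(z)] *: row i g) t := monic_shift U_(z)%MM (monic_basis i).
set h0 := 'X_[U_(z)] *: row i g in mh0.
have Uh0 : U h0 by apply: (lb_mul LB); apply: (lb_U LB).
have [h01 h0lt h0deg] := mh0; have red := cancel_lead h0lt mh.
rewrite h01 scale1r in red.
have [_ _ hdeg] := mh.
have [c [c1 c2]] : exists c : 'rV[P]_r,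
    (forall l m, (c 0 l)@_m != 0 -> pred1 2 (mdeg m).+1 /\ tltb (k l, (U_(y l) + m)%MM) t) /\
    forall j, I ((h0 - h - c *m g) 0 j).
  (* Admitting degree 2 alone forces every cofactor term to have degree 1. *)
  apply: (@division 2 (pred1 2) (fun s => tltb s t)).
  - by move=> a /eqP->.
  - by move=> a s; apply: tlt_tr.
  - exact: (lb_sub LB).
  move=> s /red[st hs]; split=> //=; apply/eqP.
  by case: hs => [/h0deg|[/hdeg]] ->; rewrite mdegD !mdeg1.
have clt s : tc c s != 0 -> tltn s (i, U_(z)%MM) /\ mdeg s.2 = 1%N.
  by case: s => l m /c1 [/eqP[] -> /tlt_next].
exists ('X_[U_(z)] *: delta_mx 0 i - e - c).
  move=> j; rewrite !mulmxBl -scalemxAl -rowE -/h0.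
  have -> : (h0 - e *m g - c *m g) 0 j = (h0 - h - c *m g) 0 j + (h - e *m g) 0 j.
    by rewrite !mxE; ring.
  exact: I_add.
have tcE s : tc ('X_[U_(z)] *: delta_mx 0 i - e - c) s =
    (s == (i, U_(z)%MM))%:R - tc e s - tc c s.
  case: s => l m; rewrite !tcB xpair_eqE /tc scale_delta_mxE /=; congr (_ - _ - _).
  by case: eqP => _; rewrite ?mcoeff0 // mcoeffX eq_sym.
have nlt s : tc ('X_[U_(z)] *: delta_mx 0 i - e - c) s != 0 -> s != (i, U_(z)%MM) ->
    tltn s (i, U_(z)%MM) /\ mdeg s.2 = 1%N.
  rewrite tcE => h' /negbTE ns; move: h'; rewrite ns sub0r.
  have [->|/elt//] := eqVneq (tc e s) 0; have [->|/clt//] := eqVneq (tc c s) 0.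
  by rewrite !oppr0 addr0 eqxx.
have z0 (v : 'rV[P]_r) : (forall s, tc v s != 0 -> tltn s (i, U_(z)%MM) /\ mdeg s.2 = 1%N) ->
    tc v (i, U_(z)%MM) = 0.
  by move=> hv; apply/eqP/negPn/negP => /hv[]; rewrite tlt_irr.
split=> [|s hs ne|s hs].
- by rewrite tcE eqxx (z0 _ elt) (z0 _ clt) !subr0.
- by have [] := nlt _ hs ne.
have [->//|ne] := eqVneq s (i, U_(z)%MM).
by have [_ ->] := nlt _ hs ne; rewrite mdeg1.
Qed.

(** The comparison of a term of [f] with its leading term and that of a term of row [l] with its
    leading term add up, and the weights cancel. In the case of equality both are tight; only an
    earlier row in position [k i] whose variable divides [m] could then compete, and the hypothesis
    excludes it. *)
Lemma syz_lead_product f i m l a c : lead_term next_w next_rho f (i, m) ->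
  ~~ [exists l, [&& k l == k i, (y l < y i)%N & (0 < m (y l))%N]] ->
  tc f (l, a) != 0 -> (g l (k i))@_c != 0 ->
  mole lt (a + c)%MM (m + U_(y i))%MM /\
  ((a + c = m + U_(y i))%MM -> [/\ l = i, a = m & c = U_(y i)%MM]).
Proof.
move=> [fn0 fmax] nex fa gc.
have [le1 rho1] : mole lt (a + next_w l)%MM (m + next_w i)%MM /\
    ((a + next_w l = m + next_w i)%MM -> l = i \/ (next_rho l < next_rho i)%N).
  have [[-> ->]|ne] := eqVneq (l, a) (i, m); first by split; [apply: mole_refl | left].
  have /= /orP[h|/andP[/eqP h r']] := fmax _ fa ne; rewrite /mole ?h ?eqxx /= ?orbT; split=> //.
    by move=> e; move: h; rewrite /= e (mo_irr ltO).
  by right.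
have [le2 rho2] : mole lt (c + w (k i))%MM (U_(y l) + w (k l))%MM /\
    ((c + w (k i) = U_(y l) + w (k l))%MM -> (k i, c) = (k l, U_(y l)%MM) \/
       (rho (k i) < rho (k l))%N).
  have [e|ne] := eqVneq (k i, c) (k l, U_(y l)%MM).
    by case: e => -> ->; split; [apply: mole_refl | left].
  have /= /orP[h|/andP[/eqP h r']] := lb_lt LB gc ne; rewrite /mole ?h ?eqxx /= ?orbT; split=> //.
    by move=> e; move: h; rewrite /= e (mo_irr ltO).
  by right.
pose W := (U_(y l) + w (k l) + w (k i))%MM.
have eL : (a + next_w l + (c + w (k i)) = a + c + W)%MM by rewrite /next_w /W; mnm_lia.
have eR : (m + next_w i + (U_(y l) + w (k l)) = m + U_(y i) + W)%MM by rewrite /next_w /W; mnm_lia.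
split=> [|e].
  by have := mole_add ltO le1 le2; rewrite eL eR (mole_add2r ltO).
have [e1 e2] := mole_add_eq ltO le1 le2 (etrans eL (etrans (congr1 (fun x => (x + W)%MM) e) (esym eR))).
have [[kil cy]|/next_rho_lt il] := rho2 e2; last first.
  by case: (rho1 e1) => [li|]; [rewrite li ltnn in il | lia].
have [li|] := rho1 e1.
  by subst l; split=> //; move: e1 => /addIm.
rewrite /next_rho kil ltn_add2l => yli; case/negP: nex; apply/existsP; exists l.
rewrite kil eqxx yli /=; have /mnmP/(_ (y l)) := e; rewrite cy !mnmDE !mnm1E eqxx.
by have /negbTE -> : y i != y l; [apply: contraTneq yli => ->; rewrite ltnn | lia].
Qed.

(** If no earlier row explains the leading term, then [m + U_(y i)] survives as leading monomial of
    the component [k i] of [f *m g], an element of [I]. A bad pair divides it, and either contains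
    [y i], so that its other variable divides [m], or already divides [m]. *)
Lemma syz_init f t : syz f -> lead_term next_w next_rho f t ->
  (exists x z, bad x z /\ (U_(x) + U_(z) <= t.2)%MM) \/
  exists2 z, next_pair z t.1 & (0 < t.2 z)%N.
Proof.
case: t => i m /= sf ft.
have [/existsP[l /and3P[kl yl ml]]|nex] :=
    boolP [exists l, [&& k l == k i, (y l < y i)%N & (0 < m (y l))%N]].
  by right; exists (y l) => //; apply/orP; right; apply/existsP; exists l; rewrite kl yl eqxx.
have tight := syz_lead_product ft nex.
have [fn0 _] := ft.
pose p := (f *m g) 0 (k i).
have pE M : p@_M = \sum_l (f 0 l * g l (k i))@_M by rewrite /p mxE raddf_sum.
have pM : p@_(m + U_(y i)) = tc f (i, m).
  rewrite pE (bigD1 i) //= big1 ?addr0 => [|l li]; last first.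
    apply/eqP/negPn/negP => /mcoeffM_neq0[a [c [e fa gc]]].
    by have [_ /(_ (esym e))[eli]] := tight _ _ _ fa gc; rewrite eli eqxx in li.
  (* Split off the leading variable of row [i]; by tightness the rest contributes nothing at this
     monomial. *)
  rewrite -[g i (k i)](subrK 'X_(y i)) mulrDr mcoeffD.
  rewrite [in X in _ + X]addmC mcoeffMX -[RHS]add0r; congr (_ + _).
  apply/eqP/negPn/negP => /mcoeffM_neq0[a [c [e fa gc]]].
  have cy : c != U_(y i)%MM.
    apply: contraNneq gc => ->.
    by rewrite mcoeffB (lb_lead LB) mcoeffX eqxx subrr.
  have gc' : (g i (k i))@_c != 0.
    by move: gc; rewrite mcoeffB mcoeffX (eq_sym U_(y i)%MM) (negbTE cy) subr0.
  by have [_ /(_ (esym e))[_ _ ec]] := tight _ _ _ fa gc'; rewrite ec eqxx in cy.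
have plead : is_initial_mon lt p (m + U_(y i))%MM.
  split=> [|M]; rewrite mcoeff_msupp; first by rewrite pM.
  move=> pn0 ne; have /existsP[l] : [exists l, (f 0 l * g l (k i))@_M != 0].
    apply: contraR pn0; rewrite negb_exists => /forallP h; rewrite pE big1 // => l _.
    by apply/eqP/negPn/h.
  move=> /mcoeffM_neq0[a [c [e fa gc]]]; subst M.
  by have [le _] := tight _ _ _ fa gc; apply: mole_neq_lt.
have [x [z [xz /mnm_lepP le]]] := lead_bad (sf _) plead.
have [xy|xy] := eqVneq x (y i).
  right; exists z; first by rewrite /next_pair bad_sym -xy xz.
  by have := le z; rewrite -xy !mnmDE !mnm1E eqxx; lia.
have [zy|zy] := eqVneq z (y i).
  right; exists x; first by rewrite /next_pair -zy xz.
  by have := le x; rewrite -zy !mnmDE !mnm1E eqxx; lia.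
left; exists x, z; split=> //; apply/mnm_lepP => v; have := le v; rewrite !mnmDE !mnm1E.
by have [<-|] := eqVneq (y i) v; [rewrite (negbTE xy) (negbTE zy) | rewrite addn0].
Qed.

End Division.

Lemma linear_basis_syz b w rho U r y k g : @linear_basis b w rho U r y k g ->
  exists (r' : nat) (y' : 'I_r' -> 'I_N) (k' : 'I_r' -> 'I_r) (g' : 'M[P]_(r', r)),
    linear_basis (next_w w y k) (next_rho rho y k) (syz g) y' k' g'.
Proof.
move=> LB; pose A := [set q : 'I_N * 'I_r | next_pair y k q.1 q.2].
have exS (l : 'I_#|A|) : exists s : 'rV[P]_r, syz g s /\
    monic_term (next_w w y k) (next_rho rho y k) s ((enum_val l).2, U_((enum_val l).1)%MM).
  have [|s s1 s2] := @syz_with_lead _ _ _ _ _ _ _ _ LB (enum_val l).1 (enum_val l).2.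
    by have := enum_valP l; rewrite inE.
  by exists s.
have [S hS] := fin_all_exists exS.
have tcS l i m : tc (S l) (i, m) = ((\matrix_(l, j) S l 0 j) l i)@_m by rewrite mxE.
exists #|A|, (fun l => (enum_val l).1), (fun l => (enum_val l).2), (\matrix_(l, j) S l 0 j).
split.
- move=> l i; rewrite /next_rho => e.
  have [ly iy] := (ltn_ord (y l), ltn_ord (y i)).
  (* [next_rho] is written in base [N] with last digit [y l], so it determines [rho (k l)] and
     [y l]. *)
  have rk : rho (k l) = rho (k i) by nia.
  apply: (lb_inj LB); rewrite (lb_rho LB rk); congr (_, _); apply: val_inj => /=; nia.
- by move=> f h sf sh j; rewrite mulmxBl !mxE; have := I_sub (sf j) (sh j); rewrite !mxE.
- by move=> p f sf j; rewrite -scalemxAl mxE; apply: I_mul.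
- move=> f If j; rewrite mxE; apply: (big_ind I) => // l _.
  by rewrite mulrC; apply: I_mul.
- move=> l l' /= [e1 e2]; apply: enum_val_inj; move: e1 e2.
  by case: (enum_val l) => a c; case: (enum_val l') => a' c' /= -> ->.
- move=> l j; apply/dhomogP => m; rewrite mcoeff_msupp -tcS.
  by have [_ [_ _ h]] := hS l; move/h => /= ->; rewrite mdeg1.
- by move=> l; have [_ [h _ _]] := hS l; rewrite -tcS.
- by move=> l j m; rewrite -tcS; have [_ [_ h _]] := hS l; apply: h.
- move=> l; have [h _] := hS l; move=> j; have := h j; congr (I (fun_of_matrix (_ *m g) _ _)).
  by apply/rowP => i; rewrite !mxE.
move=> f t sf ft; have [h|[z zt tz]] := syz_init LB sf ft; [by left | right].
have Azt : (z, t.1) \in A by rewrite inE.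
by exists (enum_rank_in Azt (z, t.1)); rewrite enum_rankK_in.
Qed.

End SchreyerStep.

(** * The linear resolution of the residue field *)

Section Koszul.
Variables (K : fieldType) (N d : nat) (gens : N.-tuple {mpoly K[d]}).
Variable lt : rel 'X_{1..N}.
Hypothesis ltO : monomial_order lt.
Local Notation P := {mpoly K[N]}.
Let I (p : P) : Prop := p \mPo gens = 0.
Hypothesis I_const : forall p, I p -> p@_0%MM = 0.
Variable bad : rel 'I_N.
Hypothesis bad_sym : forall x y, bad x y = bad y x.
Hypothesis bad_lead : forall x y, bad x y ->
  exists q, [/\ I q, q \is 2.-homog & is_initial_mon lt q (U_(x) + U_(y))%MM].
Hypothesis lead_bad : forall p m, I p -> is_initial_mon lt p m ->
  exists x y, bad x y /\ (U_(x) + U_(y) <= m)%MM.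

Let I_sub p q : I p -> I q -> I (p - q).
Proof. by rewrite /I comp_mpolyB => -> ->; rewrite subrr. Qed.
Let I_mul (p q : P) : I q -> I (p * q).
Proof. by rewrite /I rmorphM /= => ->; rewrite mulr0. Qed.
Let I0 : I 0. Proof. exact: comp_mpoly0. Qed.

(** The ranks are outputs of the induction, so a level packages them with its data;
    [lv_b (next_level v)] is [lv_r v] by conversion, which lets consecutive matrices compose. *)
Record level := Level {
  lv_b : nat; lv_r : nat;
  lv_w : 'I_lv_b -> 'X_{1..N}; lv_rho : 'I_lv_b -> nat; lv_U : 'rV[P]_lv_b -> Prop;
  lv_y : 'I_lv_r -> 'I_N; lv_k : 'I_lv_r -> 'I_lv_b; lv_g : 'M[P]_(lv_r, lv_b);
  lv_ok : linear_basis lt I bad lv_w lv_rho lv_U lv_y lv_k lv_g }.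

(** The start is the irrelevant ideal of [K[X]] with the variables as basis; [I_const] places [I]
    inside it. *)
Lemma level0_ok : @linear_basis K N lt I bad 1 (fun _ => 0%MM) (fun _ => 0%N)
  (fun f => (f 0 0)@_0%MM = 0) N id (fun _ => 0) (\matrix_(l, j) 'X_l).
Proof.
split=> //.
- by move=> i j _; rewrite !ord1.
- by move=> f h fU hU; rewrite !mxE mcoeffB fU hU subrr.
- move=> p f fU; rewrite mxE; apply/eqP/negPn/negP => /mcoeffM_neq0[a [c [e _]]].
  by move/esym/eqP: e; rewrite mnmD_eq0 => /andP[_ /eqP->]; rewrite fU eqxx.
- by move=> f If; apply: I_const.
- by move=> l l' [].
- by move=> l j; rewrite mxE dhomogX /= mdeg1.
- by move=> l; rewrite mxE mcoeffX eqxx.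
- move=> l j m; rewrite mxE mcoeffX ord1; case: (U_(l)%MM =P m) => [<-|_ /eqP[]//].
  by rewrite eqxx.
- by move=> l; rewrite !mxE mcoeffX mnm1_eq0.
move=> f [j m] fU [/= f0 _]; right; move: f0; rewrite /tc /= ord1 => fm.
have : m != 0%MM by apply: contraNneq fm => ->; rewrite fU.
rewrite -mdeg_eq0 mdegE sum_nat_eq0 negb_forall => /existsP[x mx].
by exists x => //; rewrite lt0n.
Qed.

Lemma next_level_exists (v : level) :
  exists e : {r' : nat & (('I_r' -> 'I_N) * ('I_r' -> 'I_(lv_r v)) * 'M[P]_(r', lv_r v))%type},
    linear_basis lt I bad (next_w (@lv_w v) (@lv_y v) (@lv_k v))
      (next_rho (@lv_rho v) (@lv_y v) (@lv_k v)) (syz I (lv_g v))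
      (projT2 e).1.1 (projT2 e).1.2 (projT2 e).2.
Proof.
have [r [y [k [g h]]]] := linear_basis_syz ltO I_sub I_mul I0 bad_sym bad_lead lead_bad (lv_ok v).
by exists (existT _ r (y, k, g)).
Qed.

Definition next_level (v : level) : level :=
  Level (svalP (constructive_indefinite_description _ (next_level_exists v))).

Fixpoint levels (n : nat) : level :=
  if n is n'.+1 then next_level (levels n') else Level level0_ok.

Lemma lift_row b (x : 'rV[{mpoly K[d]}]_b) :
  (forall i, exists p : P, x 0 i = p \mPo gens) ->
  exists X : 'rV[P]_b, x = map_mx (comp_mpoly gens) X.
Proof.
move=> h; have [X hX] := fin_all_exists h.
by exists (\row_i X i); apply/rowP => i; rewrite !mxE.
Qed.

Lemma map_row0 b (X : 'rV[P]_b) : map_mx (comp_mpoly gens) X = 0 <-> forall j, I (X 0 j).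
Proof.
split=> [h j|h]; last by apply/rowP => j; rewrite !mxE; apply: h.
by have /rowP/(_ j) := h; rewrite !mxE.
Qed.

Lemma level_span (v : level) (X : 'rV[P]_(lv_b v)) :
  lv_U X -> exists c : 'rV[P]_(lv_r v), forall j, I ((X - c *m lv_g v) 0 j).
Proof.
move=> UX; pose D := (\max_j msize (X 0%R j))%N.
have hX t : tc X t != 0 -> (mdeg t.2 <= D)%N /\ predT t.
  case: t => j m; rewrite /tc /= -mcoeff_msupp => mX; split=> //.
  by apply: leq_trans (leq_bigmax j); apply: ltnW; apply: msize_mdeg_lt.
have [c [_ c2]] := division ltO I_sub I_mul I0 bad_lead (lv_ok v)
  (Q := fun e => (e <= D)%N) (L := predT) (fun _ h => h) (fun _ _ _ h => h) UX hX.
by exists c.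
Qed.

Theorem koszul_of_quadratic_initial_ideal :
  koszul_ring (fun f => exists p : P, f = p \mPo gens)
    (fun f => exists p : P, p \is 1.-homog /\ f = p \mPo gens)
    (fun f => exists p : P, p@_0%MM = 0 /\ f = p \mPo gens).
Proof.
pose dd (v : level) := map_mx (comp_mpoly gens) (lv_g v).
exists (fun k => lv_r (levels k)), (dd (levels 0)), (fun k => dd (levels k.+1)).
have lin v i j : exists p : P, p \is 1.-homog /\ dd v i j = p \mPo gens.
  by exists (lv_g v i j); split; [apply: (lb_lin (lv_ok v)) | rewrite mxE].
split; first exact: lin.
split; first by move=> k; apply: lin.
(* Membership in [lv_U] becomes membership in a row span over R. At the next level [lv_U] is the
   syzygy condition, so this equivalence yields both the presentation of the irrelevant ideal and
   exactness everywhere. *)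
have exact v (X : 'rV[P]_(lv_b v)) : lv_U X <->
    exists c : 'rV[P]_(lv_r v), map_mx (comp_mpoly gens) X = map_mx (comp_mpoly gens) c *m dd v.
  split=> [/level_span[c /map_row0]|[c]].
    by rewrite map_mxB map_mxM => /subr0_eq; exists c.
  rewrite -map_mxM => /eqP; rewrite -subr_eq0 -map_mxB => /eqP/map_row0 h.
  have -> : X = (X - c *m lv_g v) - (0 - c *m lv_g v) by rewrite sub0r opprK subrK.
  have LB := lv_ok v; have U0 : lv_U (0 : 'rV[P]_(lv_b v)) by apply: (lb_I LB) => j; rewrite mxE.
  have UN (f : 'rV[P]_(lv_b v)) : lv_U f -> lv_U (- f) by move=> Uf; rewrite -[- f]sub0r; apply: (lb_sub LB).
  apply: (lb_sub LB); first exact: (lb_I LB).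
  apply: (lb_sub LB) => //; rewrite mulmx_sum_row.
  apply: (big_ind (@lv_U v)) => // [f f' Uf Uf'|l _].
    by rewrite -[f']opprK; apply: (lb_sub LB) => //; apply: UN.
  by apply: (lb_mul LB); apply: (lb_U LB).
have step v (x : 'rV_(lv_r v)) : (forall i, exists p : P, x 0 i = p \mPo gens) ->
    (x *m dd v = 0 <-> exists y : 'rV_(lv_r (next_level v)),
      (forall i, exists p : P, y 0 i = p \mPo gens) /\ x = y *m dd (next_level v)).
  move=> /lift_row[X ->]; rewrite -map_mxM.
  have E := exact (next_level v) X.
  split=> [/map_row0/E[c ->]|[y [/lift_row[c ->] e]]].
    by exists (map_mx (comp_mpoly gens) c); split=> // i; exists (c 0 i); rewrite mxE.
  by apply/map_row0; apply/E; exists c.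
split.
  move=> f; have E := exact (levels 0); split=> [[p [p0 ->]]|[x [/lift_row[c ->] ->]]].
    have [|c ec] := (E (const_mx p)).1; first by rewrite /= mxE.
    exists (map_mx (comp_mpoly gens) c); split=> [i|]; first by exists (c 0 i); rewrite mxE.
    by rewrite -ec !mxE.
  exists ((c *m lv_g (levels 0)) 0 0); split; last by rewrite -map_mxM mxE.
  by apply: (E (c *m lv_g (levels 0))).2; exists c; rewrite map_mxM.
by split=> [x|k x]; apply: step.
Qed.

End Koszul.

(** * Toric kernels and tables *)

Section ToricKernel.
Variables (K : fieldType) (N d : nat) (gens : N.-tuple {mpoly K[d]}).
Variable e : 'I_N -> 'X_{1..d}.
Hypothesis gensE : forall k, tnth gens k = 'X_[e k].

Definition toric_exp (a : 'X_{1..N}) : 'X_{1..d} := (\sum_(k < N) e k *+ a k)%MM.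

Lemma toric_expD a b : toric_exp (a + b) = (toric_exp a + toric_exp b)%MM.
Proof.
apply/mnmP => i; rewrite mnmDE !mnm_sumE -big_split /=; apply: eq_bigr => k _.
by rewrite !mulmnE mnmDE mulnDr.
Qed.

Lemma comp_toricX a : 'X_[a] \mPo gens = 'X_[toric_exp a].
Proof.
rewrite comp_mpolyX /toric_exp -mprodXE; apply: eq_bigr => k _.
by rewrite gensE mpolyXn.
Qed.

Lemma mcoeff_toric (p : {mpoly K[N]}) mu :
  (p \mPo gens)@_mu = \sum_(a <- msupp p | toric_exp a == mu) p@_a.
Proof.
rewrite comp_mpolyEX raddf_sum /= [RHS]big_mkcond; apply: eq_bigr => a _.
rewrite mcoeffZ comp_toricX mcoeffX.
by case: eqP; rewrite ?mulr1 ?mulr0.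
Qed.

Lemma toric_ker_binomial a b : toric_exp a = toric_exp b -> ('X_[a] - 'X_[b]) \mPo gens = 0.
Proof. by move=> ab; rewrite comp_mpolyB !comp_toricX ab subrr. Qed.

(** The coefficient of the image at [toric_exp e a] is the sum of [p] over the fibre of [a]; it
    vanishes, so it cannot consist of the nonzero [p@_a] alone. *)
Lemma toric_ker_other (p : {mpoly K[N]}) a : p \mPo gens = 0 -> a \in msupp p ->
  exists b, [/\ b \in msupp p, b != a & toric_exp b = toric_exp a].
Proof.
move=> Ip ap; have := mcoeff_toric p (toric_exp a); rewrite Ip mcoeff0.
have [/hasP[b bp /andP[/eqP e1 ba]] _|nh] :=
    boolP (has (fun b => (toric_exp b == toric_exp a) && (b != a)) (msupp p)).
  by exists b.
rewrite big_mkcond (bigD1_seq a) ?msupp_uniq //= eqxx big1_seq ?addr0 => [/esym/eqP|b /andP[ba bp]].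
  by move: ap; rewrite mcoeff_msupp => /negbTE ->.
case: ifP => // e1; case/negP: nh; apply/hasP; exists b => //; exact/andP.
Qed.

Lemma toric_ker_singleton (p : {mpoly K[N]}) a : p \mPo gens = 0 ->
  (forall b, toric_exp b = toric_exp a -> b = a) -> p@_a = 0.
Proof.
move=> Ip sing; apply/eqP/negPn/negP; rewrite -mcoeff_msupp.
by case/(toric_ker_other Ip) => b [_ /eqP ba /sing].
Qed.

End ToricKernel.

(** Every coefficient of an image is a sum over one fibre, so the kernel depends only on the
    partition of the monomials into fibres. *)
Lemma toric_ker_fibers (K : fieldType) N d d' (gens : N.-tuple {mpoly K[d]})
    (gens' : N.-tuple {mpoly K[d']}) e e' (p : {mpoly K[N]}) :
  (forall k, tnth gens k = 'X_[e k]) -> (forall k, tnth gens' k = 'X_[e' k]) ->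
  (forall a b, toric_exp e' a = toric_exp e' b -> toric_exp e a = toric_exp e b) ->
  (forall a b, toric_exp e a = toric_exp e b -> toric_exp e' a = toric_exp e' b) ->
  p \mPo gens = 0 -> p \mPo gens' = 0.
Proof.
move=> gE gE' ee' e'e Ip; apply/mpolyP => mu; rewrite (mcoeff_toric gE') mcoeff0.
have [/hasP[b bp /eqP <-]|nh] := boolP (has (fun b => toric_exp e' b == mu) (msupp p)); last first.
  by rewrite big_hasC.
transitivity ((p \mPo gens)@_(toric_exp e b)); last by rewrite Ip mcoeff0.
rewrite (mcoeff_toric gE); apply: eq_bigl => a.
by apply/eqP/eqP; [apply: ee' | apply: e'e].
Qed.

Definition cnt N (a : 'X_{1..N}) (Q : pred 'I_N) : nat := \sum_(x | Q x) a x.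

(** With abstract labels and a bare predicate, transposing the table exchanges [row] and [col], and
    complementing [S] replaces [s] by [predC s]. *)
Definition same_margins N (A B : eqType) (row : 'I_N -> A) (col : 'I_N -> B) (s : pred 'I_N)
    (a b : 'X_{1..N}) : Prop :=
  [/\ forall i, cnt a [pred x | row x == i] = cnt b [pred x | row x == i],
      forall j, cnt a [pred x | col x == j] = cnt b [pred x | col x == j],
      cnt a s = cnt b s & cnt a (predC s) = cnt b (predC s)].

Section Table.
Variables (m n : nat) (Hn : (0 < n)%N) (S : {set 'I_m * 'I_n}).

Lemma row_of_subproof (k : 'I_(m * n)) : (k %/ n < m)%N.
Proof. by rewrite ltn_divLR. Qed.
Lemma col_of_subproof (k : 'I_(m * n)) : (k %% n < n)%N.
Proof. by rewrite ltn_mod. Qed.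
Definition row_of k : 'I_m := Ordinal (row_of_subproof k).
Definition col_of k : 'I_n := Ordinal (col_of_subproof k).

Lemma cell_of_subproof (i : 'I_m) (j : 'I_n) : (i * n + j < m * n)%N.
Proof. by have := ltn_ord i; have := ltn_ord j; nia. Qed.
Definition cell_of i j : 'I_(m * n) := Ordinal (cell_of_subproof i j).

Lemma cell_ofK1 i j : row_of (cell_of i j) = i.
Proof. by apply: val_inj; rewrite /= divnMDl // divn_small ?addn0. Qed.
Lemma cell_ofK2 i j : col_of (cell_of i j) = j.
Proof. by apply: val_inj; rewrite /= modnMDl modn_small. Qed.
Lemma row_col_ofK k : cell_of (row_of k) (col_of k) = k.
Proof. by apply: val_inj; rewrite /= -divn_eq. Qed.

Definition in_S k := (row_of k, col_of k) \in S.

Definition u_var (i : 'I_m) : 'I_(m + n).+2 := inord i.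
Definition v_var (j : 'I_n) : 'I_(m + n).+2 := inord (m + j).
Definition w_var : 'I_(m + n).+2 := inord (m + n).
Definition t_var : 'I_(m + n).+2 := inord (m + n).+1.

Definition gen_exp k : 'X_{1..(m + n).+2} :=
  (U_(u_var (row_of k)) + U_(v_var (col_of k)) + U_(if in_S k then w_var else t_var))%MM.

Lemma gens_SE (K : fieldType) k : tnth (gens_S K S) k = 'X_[gen_exp k].
Proof.
rewrite tnth_mktuple /gen_S /gen_exp !mpolyXD; congr (_ * _ * _).
rewrite /in_S; have -> : [exists c in S, ((c.1 : nat) == k %/ n)%N && ((c.2 : nat) == k %% n)%N] =
    ((row_of k, col_of k) \in S).
  apply/existsP/idP => [[[i j] /and3P[cS /eqP /= e1 /eqP e2]]|kS].
    by rewrite (_ : (_, _) = (i, j)) //; congr (_, _); apply: val_inj.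
  by exists (row_of k, col_of k); rewrite kS /= !eqxx.
by case: ifP.
Qed.

Lemma toric_exp_sumE k a : toric_exp gen_exp a k = \sum_(x < m * n) (gen_exp x k * a x)%N.
Proof. by rewrite /toric_exp mnm_sumE; apply: eq_bigr => x _; rewrite mulmnE. Qed.

Lemma toric_exp_cnt k a (Q : pred _) : (forall x, gen_exp x k = nat_of_bool (Q x)) ->
  toric_exp gen_exp a k = cnt a Q.
Proof.
move=> h; rewrite toric_exp_sumE /cnt [RHS]big_mkcond; apply: eq_bigr => x _.
by rewrite h; case: (Q x); rewrite ?mul1n ?mul0n.
Qed.

Lemma u_varE i : u_var i = i :> nat.
Proof. by rewrite inordK //; have := ltn_ord i; lia. Qed.
Lemma v_varE j : v_var j = (m + j)%N :> nat.
Proof. by rewrite inordK //; have := ltn_ord j; lia. Qed.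
Lemma w_varE : w_var = (m + n)%N :> nat.
Proof. by rewrite inordK. Qed.
Lemma t_varE : t_var = (m + n).+1%N :> nat.
Proof. by rewrite inordK. Qed.

Let varE := (u_varE, v_varE, w_varE, t_varE).

Lemma toric_u i a : toric_exp gen_exp a (u_var i) = cnt a [pred x | row_of x == i].
Proof.
apply: toric_exp_cnt => x; rewrite !mnmDE !mnm1E /= -!val_eqE (fun_if val) /= !varE /=.
by have := ltn_ord i; case: ifP; lia.
Qed.
Lemma toric_v j a : toric_exp gen_exp a (v_var j) = cnt a [pred x | col_of x == j].
Proof.
apply: toric_exp_cnt => x; rewrite !mnmDE !mnm1E /= -!val_eqE (fun_if val) /= !varE /=.
by have := ltn_ord j; have := row_of_subproof x; case: ifP; lia.
Qed.
Lemma toric_w a : toric_exp gen_exp a w_var = cnt a in_S.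
Proof.
apply: toric_exp_cnt => x; rewrite !mnmDE !mnm1E /= -!val_eqE (fun_if val) /= !varE /=.
by have := row_of_subproof x; have := col_of_subproof x; case: ifP; lia.
Qed.
Lemma toric_t a : toric_exp gen_exp a t_var = cnt a (predC in_S).
Proof.
apply: toric_exp_cnt => x; rewrite !mnmDE !mnm1E /= -!val_eqE (fun_if val) /= !varE /=.
by have := row_of_subproof x; have := col_of_subproof x; case: ifP; lia.
Qed.

Lemma amb_var_cases (k : 'I_(m + n).+2) :
  [\/ exists i, k = u_var i, exists j, k = v_var j, k = w_var | k = t_var].
Proof.
have kl := ltn_ord k.
have [km|km] := ltnP k m.
  by constructor 1; exists (Ordinal km); apply: val_inj; rewrite /= u_varE.
have [kn|kn] := ltnP k (m + n).
  have kj : (k - m < n)%N by lia.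
  by constructor 2; exists (Ordinal kj); apply: val_inj; rewrite /= v_varE /=; lia.
have [kw|kw] := eqVneq (k : nat) (m + n)%N.
  by constructor 3; apply: val_inj; rewrite /= w_varE.
by constructor 4; apply: val_inj; rewrite /= t_varE; lia.
Qed.

Lemma same_marginsP a b : toric_exp gen_exp a = toric_exp gen_exp b <->
  same_margins row_of col_of in_S a b.
Proof.
split=> [ab|[hu hv hw ht]].
  by split=> [i|j||]; rewrite -?toric_u -?toric_v -?toric_w -?toric_t ab.
apply/mnmP => k; case: (amb_var_cases k) => [[i ->]|[j ->]|->|->].
- by rewrite !toric_u.
- by rewrite !toric_v.
- by rewrite !toric_w.
by rewrite !toric_t.
Qed.

End Table.

(** * The obstruction *)

Lemma ideal_gen_monomial (K : fieldType) N (G : {mpoly K[N]} -> Prop) M :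
  (forall q, G q -> exists a, q = 'X_[a]) -> ideal_gen G 'X_[M] ->
  exists2 a, G 'X_[a] & (a <= M)%MM.
Proof.
move=> Gmon [s [sG sE]].
have /hasP[q qs qM] : has (fun q => (q.1 * q.2)@_M != 0) s.
  apply: contraT => /hasPn h; have := congr1 (mcoeff M) sE.
  rewrite mcoeffX eqxx raddf_sum /= big1_seq => [/eqP|q /andP[_ qs]]; first by rewrite oner_eq0.
  by apply/eqP/negPn/h.
have [a ea] := Gmon _ (sG _ qs); exists a; first by rewrite -ea; apply: sG.
have [x [c [-> _]]] := mcoeffM_neq0 qM.
by rewrite ea -mcoeff_msupp msuppX inE => /eqP->; apply: lem_addl.
Qed.

(* The obstruction: a fibre {M0, M1} of degree 4 all of whose proper divisors are
   alone in their fibres, as happens for the 2 x 3 table with rows (1,0,0), (0,1,0). *)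
Section Obstruction.
Variables (K : fieldType) (N d : nat) (gens : N.-tuple {mpoly K[d]}).
Variable e : 'I_N -> 'X_{1..d}.
Hypothesis gensE : forall k, tnth gens k = 'X_[e k].
Local Notation P := {mpoly K[N]}.
Local Notation phi := (toric_exp e).
Let I (p : P) : Prop := p \mPo gens = 0.
Variables c11 c12 c13 c21 c22 c23 : 'I_N.
Let M0 : 'X_{1..N} := (U_(c11) + U_(c12) + (U_(c23) + U_(c23)))%MM.
Let M1 : 'X_{1..N} := (U_(c21) + U_(c22) + (U_(c13) + U_(c13)))%MM.
Hypothesis sing0 : forall b b', (b <= M0)%MM -> b != M0 -> phi b' = phi b -> b' = b.
Hypothesis sing1 : forall b b', (b <= M1)%MM -> b != M1 -> phi b' = phi b -> b' = b.
Hypothesis eqM : phi M0 = phi M1.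
Hypothesis c13_new : c13 \notin [:: c11; c12; c23].

Let mdegM0 : mdeg M0 = 4%N. Proof. by rewrite /M0 !mdegD !mdeg1. Qed.
Let mdegM1 : mdeg M1 = 4%N. Proof. by rewrite /M1 !mdegD !mdeg1. Qed.

Let M01 : M0 != M1.
Proof.
apply/negP => /eqP/mnmP/(_ c13); rewrite /M0 /M1 !mnmDE !mnm1E eqxx.
move: c13_new; rewrite !inE !negb_or ![c13 == _]eq_sym => /and3P[/negbTE-> /negbTE-> /negbTE->].
by lia.
Qed.

Let proper0 q b : I q -> (b <= M0)%MM -> b != M0 -> q@_b = 0.
Proof. by move=> Iq bM bn; apply: (toric_ker_singleton gensE Iq) => b'; apply: sing0. Qed.
Let proper1 q b : I q -> (b <= M1)%MM -> b != M1 -> q@_b = 0.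
Proof. by move=> Iq bM bn; apply: (toric_ker_singleton gensE Iq) => b'; apply: sing1. Qed.

(** Elements of [I] vanish at all proper divisors of [M0], so this coefficient is the constant term
    of [p] times the coefficient of [q] at [M0]. It is the source of the contradictions about
    generators and resolutions: the binomial [B] below has coefficient 1 at [M0]. *)
Let zero_mul p q : I q -> p@_0%MM = 0 \/ q@_M0 = 0 -> (p * q)@_M0 = 0.
Proof.
move=> Iq pq; apply/eqP/negPn/negP => /mcoeffM_neq0[a [c [E pa qc]]].
have cM : c = M0.
  apply: contraTeq qc => cM; rewrite (proper0 Iq) ?eqxx //.
  by rewrite E; apply: lem_addl.
have a0 : a = 0%MM.
  by apply: (@addIm _ M0); rewrite add0m -[in LHS]cM.
by case: pq => h; [rewrite a0 h eqxx in pa | rewrite cM h eqxx in qc].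
Qed.

Let deg2_M0 (q : P) : q \is 2.-homog -> q@_M0 = 0.
Proof.
move=> /dhomogP qh; apply/eqP/negPn/negP; rewrite -mcoeff_msupp => /qh /=.
by rewrite mdegM0.
Qed.

Let B : P := 'X_[M0] - 'X_[M1].
Let IB : I B. Proof. exact: (toric_ker_binomial gensE eqM). Qed.
Let B_M0 : B@_M0 = 1.
Proof. by rewrite mcoeffB !mcoeffX eqxx eq_sym (negbTE M01) subr0. Qed.

Lemma not_generated_by_quadrics (G : P -> Prop) :
  (forall g, G g -> I g /\ g \is 2.-homog) -> ~ ideal_gen G B.
Proof.
move=> GI [s [sG sE]]; have := oner_neq0 K; rewrite -B_M0 sE raddf_sum /= big1_seq ?eqxx //.
by move=> q /andP[_ /sG/GI[Iq qh]]; apply: zero_mul => //; right; apply: deg2_M0.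
Qed.

Lemma not_gen_by_quadratic_binomials : ~ gen_by_quadratic_binomials I.
Proof.
move=> [G [GI GE]]; apply: (@not_generated_by_quadrics G); last by apply/GE.
move=> g /GI[[a [b [da [db [_ ->]]]]] Ig]; split=> //.
by apply: rpredB; rewrite dhomogX /= ?da ?db.
Qed.

Section Order.
Variable lt : rel 'X_{1..N}.
Hypothesis ltO : monomial_order lt.

Let initB : exists2 M, M \in [:: M0; M1] & initial_monomials lt I 'X_[M].
Proof.
have Bn0 : B != 0 by apply/eqP => B0; have := oner_neq0 K; rewrite -B_M0 B0 mcoeff0 eqxx.
have [M MB] := mo_lead ltO Bn0; exists M; last by exists B, M.
case: MB => + _; rewrite mcoeff_msupp mcoeffB !mcoeffX !inE ![M == _]eq_sym.
by case: (M0 == M); case: (M1 == M); rewrite ?subr0 ?eqxx.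
Qed.

Let proper_lead (M a : 'X_{1..N}) p : M \in [:: M0; M1] -> (a <= M)%MM -> a != M -> I p ->
  is_initial_mon lt p a -> False.
Proof.
move=> + aM an Ip [+ _]; rewrite mcoeff_msupp !inE => /orP[]/eqP EM; subst M.
  by rewrite (proper0 Ip) ?eqxx.
by rewrite (proper1 Ip) ?eqxx.
Qed.

(** The leading monomial of [B] contains a squared variable, so a squarefree generator dividing it
    is a proper divisor; an element of [I] would then have to lead at a proper divisor, where it
    vanishes. *)
Lemma initial_ideal_not_squarefree (A : 'X_{1..N} -> Prop) :
  (forall a, A a -> squarefree_mon a) ->
  ~ same_set (initial_ideal lt I) (ideal_gen (fun q => exists a, A a /\ q = 'X_[a])).
Proof.
move=> Asq same; have [M MM /[dup] MI [p0 [m0 _]]] := initB.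
have ini (x : P) : initial_monomials lt I x -> exists a, x = 'X_[a].
  by move=> [p [m [_ [_ [_ ->]]]]]; exists m.
have : initial_ideal lt I 'X_[M].
  exists [:: (1, 'X_[M])]; split=> [q|]; last by rewrite big_seq1 mul1r.
  by rewrite inE => /eqP->.
move/same => /ideal_gen_monomial[|a [a' [Aa' /(congr1 (@mlead _ _))]]].
  by move=> q [a [_ ->]]; exists a.
rewrite !mleadXm => -> {a}; rename a' into a => aM.
have : initial_ideal lt I 'X_[a].
  apply/same; exists [:: (1, 'X_[a])]; split=> [q|]; last by rewrite big_seq1 mul1r.
  by rewrite inE => /eqP-> /=; exists a.
case/(ideal_gen_monomial ini) => a' [p [m [Ip [pn0 [pm /(congr1 (@mlead _ _))]]]]].
rewrite !mleadXm => -> ma; apply: (proper_lead MM _ _ Ip pm).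
  by apply/mnm_lepP => i; apply: leq_trans (mnm_lepP ma i) (mnm_lepP aM i).
have two : exists i, (1 < M i)%N.
  move: MM; rewrite !inE => /orP[]/eqP->.
    by exists c23; rewrite /M0 !mnmDE !mnm1E eqxx; lia.
  by exists c13; rewrite /M1 !mnmDE !mnm1E eqxx; lia.
have [i Mi] := two; apply/negP => /eqP mM.
have := mnm_lepP ma i; rewrite mM; have /forallP/(_ i) := Asq _ Aa'.
by move: Mi; lia.
Qed.

Lemma no_quadratic_initial_ideal (G : P -> Prop) :
  (forall g, G g -> [/\ I g, g != 0 & g \is 2.-homog]) ->
  ~ same_set (initial_ideal lt I) (ideal_gen (initial_monomials lt G)).
Proof.
move=> GI same; have [M MM MI] := initB.
have : initial_ideal lt I 'X_[M].
  exists [:: (1, 'X_[M])]; split=> [q|]; last by rewrite big_seq1 mul1r.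
  by rewrite inE => /eqP->.
move/same => /ideal_gen_monomial[|a' [p [m [Gp [pn0 [pm /(congr1 (@mlead _ _))]]]]]].
  by move=> q [p [m [_ [_ [_ ->]]]]]; exists m.
rewrite !mleadXm => -> mM; have [Ip _ /dhomogP ph] := GI _ Gp.
apply: (proper_lead MM mM _ Ip pm); case: pm => /ph /= dm _.
apply: contraTneq MM => mM'; rewrite -mM' !inE negb_or.
by apply/andP; split; apply: contra_eqN dm => /eqP->; rewrite ?mdegM0 ?mdegM1.
Qed.

End Order.

Lemma no_squarefree_initial_ideal : ~ has_squarefree_initial_ideal I.
Proof. by move=> [lt [ltO [A [Asq]]]]; apply: initial_ideal_not_squarefree. Qed.

Lemma no_quadratic_groebner_basis : ~ has_quadratic_groebner_basis I.
Proof. by move=> [lt [ltO [G [GI]]]]; apply: no_quadratic_initial_ideal. Qed.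

Lemma not_normal : ~ normal_subring (fun f => exists p : P, f = p \mPo gens).
Proof.
pose s0 : 'X_{1..N} := (U_(c11) + U_(c12) + U_(c23))%MM.
(* [s1] maps to the square of the fraction [s0 / c13]: removing the common factor [c11 c12] from the
   equation of squares leaves [M0] and [M1]. *)
pose s1 : 'X_{1..N} := (U_(c11) + U_(c12) + U_(c21) + U_(c22))%MM.
move/(_ ('X_[s0] \mPo gens) ('X_c13 \mPo gens)) => [||||h [[p ->]]].
- by exists 'X_[s0].
- by exists 'X_c13.
- rewrite (comp_toricX gensE); apply/eqP => /(congr1 (mcoeff (phi U_(c13)%MM))).
  by rewrite mcoeffX eqxx mcoeff0 => /eqP; rewrite oner_eq0.
- exists 2, (fun k => if k == 2 then - ('X_[s1] \mPo gens) else 0); split=> //; split.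
    move=> k; case: eqP => _; last by exists 0; rewrite comp_mpoly0.
    by exists (- 'X_[s1]); rewrite comp_mpolyN.
  rewrite big_nat_recl // big_nat1 /= !mul0r add0r subnn expr0 mulr1 mulNr.
  apply/eqP; rewrite subr_eq0 !expr2 !(comp_toricX gensE) -!mpolyXD -!toric_expD; apply/eqP.
  congr 'X_[_].
  have -> : (s0 + s0 = M0 + (U_(c11) + U_(c12)))%MM by rewrite /s0 /M0; mnm_lia.
  have -> : (s1 + (U_(c13) + U_(c13)) = M1 + (U_(c11) + U_(c12)))%MM by rewrite /s1 /M1; mnm_lia.
  by rewrite (toric_expD _ M0) (toric_expD _ M1) eqM.
move/eqP; rewrite -subr_eq0 -rmorphM -rmorphB => /eqP Ip.
have s0M : (s0 <= M0)%MM by apply/mnm_lepP => i; rewrite /M0 /s0 !mnmDE; lia.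
have s0n : s0 != M0.
  by apply/eqP => /(congr1 mdeg); rewrite mdegM0 /s0 !mdegD !mdeg1.
have := proper0 Ip s0M s0n; rewrite mcoeffB mcoeffX eqxx.
(* The singleton fibre of [s0] forces coefficient 0 on the difference, but [c13] does not divide
   [s0], so nothing can cancel the coefficient 1. *)
have -> : ('X_c13 * p)@_s0 = 0.
  apply/eqP/negPn/negP => /mcoeffXM_neq0[a /mnmP/(_ c13) + _].
  rewrite /s0 !mnmDE !mnm1E eqxx.
  move: c13_new; rewrite !inE !negb_or ![c13 == _]eq_sym => /and3P[/negbTE-> /negbTE-> /negbTE->].
  by lia.
by rewrite subr0 => /eqP; rewrite oner_eq0.
Qed.

(** Lifted to [K[X]], the first two matrices write [B] as a combination of the quadrics [D *m L] of
    [I] and of products of elements of [I] with polynomials without constant term. All of these have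
    coefficient 0 at [M0]. *)
Lemma not_koszul : ~ koszul_ring (fun f => exists p : P, f = p \mPo gens)
    (fun f => exists p : P, p \is 1.-homog /\ f = p \mPo gens)
    (fun f => exists p : P, p@_0%MM = 0 /\ f = p \mPo gens).
Proof.
move=> [b [d0 [dd [lin0 [lin [Hplus [H0 _]]]]]]].
pose pi := comp_mpoly gens.
have [l lE] := fin_all_exists (fun i => lin0 i 0).
pose L : 'M[P]_(b 0%N, 1) := \matrix_(i, _) l i.
have LE : d0 = map_mx pi L.
  by apply/matrixP => i j; rewrite !mxE ord1; have [_ ->] := lE i.
have [De DE] := fin_all_exists (fun i => fin_all_exists (lin 0%N i)).
pose D : 'M[P]_(b 1%N, b 0%N) := \matrix_(i, j) De i j.
have DE' : dd 0%N = map_mx pi D.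
  by apply/matrixP => i j; rewrite !mxE; have [_ ->] := DE i j.
have var (k : 'I_N) : exists q : 'rV[P]_(b 0%N), I ('X_k - (q *m L) 0 0).
  have [|x [/lift_row[q ->] xE]] := (Hplus ('X_k \mPo gens)).1.
    by exists 'X_k; rewrite mcoeffX mnm1_eq0.
  exists q; rewrite /I comp_mpolyB xE LE -map_mxM mxE subrr //.
have [q1 I1] := var c11; have [q2 I2] := var c21.
pose A1 : P := 'X_[U_(c12) + (U_(c23) + U_(c23))].
pose A2 : P := 'X_[U_(c22) + (U_(c13) + U_(c13))].
have BE : B = A1 * 'X_c11 - A2 * 'X_c21.
  by rewrite /B /A1 /A2 -!mpolyXD; congr ('X_[_] - 'X_[_]); rewrite /M0 /M1; mnm_lia.
(* Expressing [c11] and [c21] through the linear forms [L] modulo [I] turns the relation [B] into a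
   syzygy of [L] over R. *)
pose r := A1 *: q1 - A2 *: q2.
have rL : (r *m L) 0 0 =
    B - A1 * ('X_c11 - (q1 *m L) 0 0) + A2 * ('X_c21 - (q2 *m L) 0 0).
  by rewrite BE /r mulmxBl -!scalemxAl !mxE; ring.
have IrL : I ((r *m L) 0 0).
  by rewrite rL /I rmorphD rmorphB !rmorphM /= I1 I2 (IB : _ = 0) !mulr0 subr0 addr0.
have rR i : exists p : P, map_mx pi r 0 i = p \mPo gens by exists (r 0 i); rewrite mxE.
have r0 : map_mx pi r *m d0 = 0.
  by rewrite LE -map_mxM; apply/map_row0 => j; rewrite ord1.
have [_ [/lift_row[Y ->] rY]] := (H0 _ rR).1 r0.
have IDL j : I ((D *m L) j 0).
  have /(H0 _ _).2 : exists y : 'rV_(b 1%N), (forall i, exists p : P, y 0 i = p \mPo gens) /\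
      row j (dd 0%N) = y *m dd 0%N.
    exists (delta_mx 0 j); split=> [i|]; last by rewrite -rowE.
    by rewrite mxE; case: (_ && _); [exists 1; rewrite comp_mpoly1 | exists 0; rewrite comp_mpoly0].
  have h : forall i, exists p : P, row j (dd 0%N) 0 i = p \mPo gens.
    by move=> i; exists (De j i); rewrite mxE; have [_ ->] := DE j i.
  move=> /(_ h); rewrite DE' -map_row LE -map_mxM => /map_row0/(_ 0).
  by rewrite -row_mul mxE.
have Ir i : I ((r - Y *m D) 0 i).
  move: i; apply/map_row0; rewrite map_mxB map_mxM -DE' rY subrr //.
have := oner_neq0 K; rewrite -B_M0.
have -> : B = ((r - Y *m D) *m L) 0 0 + (Y *m (D *m L)) 0 0
    + A1 * ('X_c11 - (q1 *m L) 0 0) - A2 * ('X_c21 - (q2 *m L) 0 0).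
  have -> : ((r - Y *m D) *m L) 0 0 = (r *m L) 0 0 - (Y *m (D *m L)) 0 0.
    by rewrite mulmxBl mulmxA !mxE.
  by rewrite rL; ring.
have lin_0 (p : P) : p \is 1.-homog -> p@_0%MM = 0.
  move=> /dhomogP h; apply/eqP/negPn/negP; rewrite -mcoeff_msupp => /h /=.
  by rewrite mdeg0.
rewrite mcoeffB !mcoeffD (zero_mul I1) ?(zero_mul I2); last 2 first.
- by left; rewrite mcoeffX !mnmD_eq0 !mnm1_eq0.
- by left; rewrite mcoeffX !mnmD_eq0 !mnm1_eq0.
rewrite ![(_ *m _) 0 0]mxE !raddf_sum /= !big1 ?addr0 ?subr0 ?eqxx // => i _.
  apply: zero_mul; first exact: IDL.
  right; apply: deg2_M0; rewrite mxE; apply: rpred_sum => j _.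
  by rewrite !mxE; apply: (@dhomogM _ _ _ 1 _ 1); [have [] := DE i j | have [] := lE j].
rewrite mulrC; apply: zero_mul; first exact: Ir.
by left; rewrite mxE; apply: lin_0; have [] := lE i.
Qed.

End Obstruction.

(** * Fibres of the 2 x 3 pattern *)

Section PatternFibre.
Variables (N : nat) (A B : eqType) (row : 'I_N -> A) (col : 'I_N -> B) (s : pred 'I_N).
Hypothesis cell_inj : forall x y, row x = row y -> col x = col y -> x = y.
Variables (r1 r2 : A) (k1 k2 k3 : B) (c11 c12 c13 c21 c22 c23 : 'I_N).
Hypotheses (r12 : r1 != r2) (k12 : k1 != k2) (k13 : k1 != k3) (k23 : k2 != k3).
Hypotheses (R1 : [/\ row c11 = r1, row c12 = r1 & row c13 = r1])
  (R2 : [/\ row c21 = r2, row c22 = r2 & row c23 = r2])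
  (C1 : col c11 = k1 /\ col c21 = k1) (C2 : col c12 = k2 /\ col c22 = k2)
  (C3 : col c13 = k3 /\ col c23 = k3).
Hypotheses (s1 : [/\ s c11, ~~ s c12 & ~~ s c13]) (s2 : [/\ ~~ s c21, s c22 & ~~ s c23]).

Definition pattern_mon : 'X_{1..N} := (U_(c11) + U_(c12) + (U_(c23) + U_(c23)))%MM.
Let six := [:: c11; c12; c13; c21; c22; c23].

Lemma six_cells x : (x \in six) = (row x \in [:: r1; r2]) && (col x \in [:: k1; k2; k3]).
Proof.
case: R1 R2 C1 C2 C3 => [a11 a12 a13] [a21 a22 a23] [b11 b21] [b12 b22] [b13 b23].
apply/idP/andP => [|[]]; rewrite !inE.
  by do ![case/orP]; move/eqP->; rewrite ?(a11, a12, a13, a21, a22, a23, b11, b21, b12, b22, b13, b23) ?eqxx ?orbT.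
have cE c : row x = row c -> col x = col c -> x == c by move=> h1 h2; apply/eqP/cell_inj.
move=> /orP[]/eqP rx; do ![case/orP]; move/eqP=> cx.
- by rewrite (cE c11) // ?rx ?cx.
- by rewrite (cE c12) ?orbT // ?rx ?cx.
- by rewrite (cE c13) ?orbT // ?rx ?cx.
- by rewrite (cE c21) ?orbT // ?rx ?cx.
- by rewrite (cE c22) ?orbT // ?rx ?cx.
- by rewrite (cE c23) ?orbT // ?rx ?cx.
Qed.

Lemma six_uniq : uniq six.
Proof.
case: R1 R2 C1 C2 C3 => [a11 a12 a13] [a21 a22 a23] [b11 b21] [b12 b22] [b13 b23].
have nr x y : row x = r1 -> row y = r2 -> x != y.
  by move=> h1 h2; apply: contraTneq r12 => xy; rewrite -h1 -h2 xy eqxx.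
have nk x y k k' : col x = k -> col y = k' -> k != k' -> x != y.
  by move=> h1 h2; apply: contraNneq => xy; rewrite -h1 -h2 xy.
rewrite /six /= !inE !negb_or.
rewrite (nk _ _ _ _ b11 b12) // (nk _ _ _ _ b11 b13) // (nk _ _ _ _ b12 b13) //.
rewrite (nk _ _ _ _ b21 b22) // (nk _ _ _ _ b21 b23) // (nk _ _ _ _ b22 b23) //.
by rewrite (nr c11 c21) // (nr c11 c22) // (nr c11 c23) // (nr c12 c21) // (nr c12 c22) //
  (nr c12 c23) // (nr c13 c21) // (nr c13 c22) // (nr c13 c23).
Qed.

Lemma cnt_six (a : 'X_{1..N}) Q : (forall x, x \notin six -> a x = 0%N) ->
  cnt a Q = (Q c11 * a c11 + Q c12 * a c12 + Q c13 * a c13 +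
    Q c21 * a c21 + Q c22 * a c22 + Q c23 * a c23)%N.
Proof.
move=> a0; have -> : cnt a Q = (\sum_(x in six) Q x * a x)%N.
  rewrite /cnt big_mkcond [RHS]big_mkcond; apply: eq_bigr => x _.
  by have [_|/a0->] := boolP (x \in six); case: (Q x); rewrite ?mul1n ?mul0n.
have <- : (\sum_(x <- six) Q x * a x = \sum_(x in six) Q x * a x)%N.
  exact: (big_uniq _ six_uniq).
by rewrite /six !big_cons big_nil addn0 !addnA.
Qed.

Lemma pattern_mon_six x : x \notin six -> pattern_mon x = 0%N.
Proof.
rewrite !inE !negb_or ![x == _]eq_sym => /and5P[/negbTE h1 /negbTE h2 _ _ /andP[_ /negbTE h3]].
by rewrite /pattern_mon !mnmDE !mnm1E h1 h2 h3.
Qed.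

Lemma pattern_margins (a b : 'X_{1..N}) :
  (forall x, x \notin six -> a x = 0%N) -> (forall x, x \notin six -> b x = 0%N) ->
  same_margins row col s a b <->
  [/\ (a c11 + a c12 + a c13 = b c11 + b c12 + b c13)%N,
      (a c21 + a c22 + a c23 = b c21 + b c22 + b c23)%N &
      [/\ (a c11 + a c21 = b c11 + b c21)%N, (a c12 + a c22 = b c12 + b c22)%N,
          (a c13 + a c23 = b c13 + b c23)%N & (a c11 + a c22 = b c11 + b c22)%N]].
Proof.
move=> a0 b0; case: R1 R2 C1 C2 C3 => [a11 a12 a13] [a21 a22 a23] [b11 b21] [b12 b22] [b13 b23].
case: s1 s2 => [s11 /negbTE s12 /negbTE s13] [/negbTE s21 s22 /negbTE s23].
have Es := (a11, a12, a13, a21, a22, a23, b11, b21, b12, b22, b13, b23, s11, s12, s13, s21, s22, s23).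
have [n1 n2 n3 n4] := And4 (negbTE r12) (negbTE k12) (negbTE k13) (negbTE k23).
have n1' : (r2 == r1) = false by rewrite eq_sym.
have n2' : (k2 == k1) = false by rewrite eq_sym.
have n3' : (k3 == k1) = false by rewrite eq_sym.
have n4' : (k3 == k2) = false by rewrite eq_sym.
have En := (n1, n1', n2, n2', n3, n3', n4, n4', eqxx).
have ca Q := cnt_six Q a0; have cb Q := cnt_six Q b0.
split=> [[hr hc hs ht]|[e1 e2 [e3 e4 e5 e6]]].
  move: (hr r1) (hr r2) (hc k1) (hc k2) (hc k3) hs.
  by rewrite !ca !cb /= !Es !En /= !(mul1n, mul0n, addn0, add0n) => *; split; [..|split].
split=> [i|j||]; rewrite !ca !cb /= !Es /=; last 2 first.
- by rewrite !(mul1n, mul0n, addn0, add0n).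
- by move: e1 e2 e6; clear; lia.
- move: e1 e2; have [<-|_] := eqVneq r1 i; first by rewrite !En; clear; lia.
  by have [_|_] := eqVneq r2 i; clear; lia.
move: e3 e4 e5; have [<-|_] := eqVneq k1 j; first by rewrite !En; clear; lia.
have [<-|_] := eqVneq k2 j; first by rewrite !En; clear; lia.
by have [_|_] := eqVneq k3 j; clear; lia.
Qed.

(** On the six cells, integer tables with zero margins and zero sum over [s] are the multiples of
    the rows (1, 1, -2), (-1, -1, 2); hence the squares in the pattern. Nonnegativity of [b']
    permits a nonzero multiple only if [b] is divisible by [pattern_mon]. *)
Lemma pattern_mon_singleton (b b' : 'X_{1..N}) : (b <= pattern_mon)%MM -> b != pattern_mon ->
  same_margins row col s b' b -> b' = b.
Proof.
move=> bM bn bb.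
have b0 x : x \notin six -> b x = 0%N.
  by move/pattern_mon_six => h; have := mnm_lepP bM x; rewrite h; lia.
have zero Q x : cnt b' Q = cnt b Q -> (forall y, Q y -> b y = 0%N) -> Q x -> b' x = 0%N.
  move=> e h Qx; move: e; rewrite /cnt (bigD1 x) //= [RHS]big1 //.
  by lia.
(* Lines that miss the pattern have margin zero, which confines [b'] to the six cells. *)
have b0' x : x \notin six -> b' x = 0%N.
  rewrite six_cells negb_and; case: bb => hr hc _ _ => /orP[h|h].
    apply: (zero _ x (hr (row x))) => [y /eqP e|/=]; last exact: eqxx.
    by apply: b0; rewrite six_cells e (negbTE h).
  apply: (zero _ x (hc (col x))) => [y /eqP e|/=]; last exact: eqxx.
  by apply: b0; rewrite six_cells e (negbTE h) andbF.
have [e1 e2 [e3 e4 e5 e6]] := (pattern_margins b0' b0).1 bb.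
have U := six_uniq; move: U; rewrite /six /= !inE !negb_or => /and5P[].
move=> /and5P[n1 n2 n3 n4 n5] /and4P[n6 n7 n8 n9] /and3P[n10 n11 n12] /andP[n13 n14] /andP[n15 _].
have ME x : pattern_mon x = ((c11 == x) + (c12 == x) + ((c23 == x) + (c23 == x)))%N.
  by rewrite /pattern_mon !mnmDE !mnm1E.
have bx x : (b x <= (c11 == x) + (c12 == x) + ((c23 == x) + (c23 == x)))%N.
  by rewrite -ME; apply: (mnm_lepP bM).
have nb : ~ (b c11 = 1%N /\ b c12 = 1%N /\ b c23 = 2%N).
  move=> [h1 [h2 h3]]; case/eqP: bn; apply/mnmP => x; rewrite ME.
  have [<-|x1] := eqVneq c11 x; first by rewrite h1 [c12 == _]eq_sym [c23 == _]eq_sym (negbTE n1) (negbTE n5).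
  have [<-|x2] := eqVneq c12 x; first by rewrite h2 [c23 == _]eq_sym (negbTE n9).
  have [<-|x3] := eqVneq c23 x; first by rewrite h3.
  by have := bx x; rewrite (negbTE x1) (negbTE x2) (negbTE x3) leqn0 => /eqP.
have := bx c11; have := bx c12; have := bx c13; have := bx c21; have := bx c22; have := bx c23.
rewrite (eq_sym c12 c11) (eq_sym c23 c11) (eq_sym c23 c12) (eq_sym c23 c13) (eq_sym c23 c21).
rewrite (eq_sym c23 c22) !eqxx.
rewrite (negbTE n1) (negbTE n5) (negbTE n9) (negbTE n2) (negbTE n6) (negbTE n12) (negbTE n3) (negbTE n7).
rewrite (negbTE n4) (negbTE n8) (negbTE n14) (negbTE n15) => f1 f2 f3 f4 f5 f6.
have d1 : b' c11 = b c11.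
  by move: e1 e2 e3 e4 e5 e6 f1 f2 f3 f4 f5 f6 nb; clear; lia.
have [d2 d3 d4 d5 d6] : [/\ b' c12 = b c12, b' c13 = b c13, b' c21 = b c21, b' c22 = b c22 & b' c23 = b c23].
  by move: e1 e2 e3 e4 e5 e6 d1; clear; split; lia.
apply/mnmP => x; have [|xs] := boolP (x \in six); last by rewrite b0 ?b0'.
by rewrite !inE; do ![case/orP]; move/eqP->.
Qed.

End PatternFibre.

Definition all_conditions_fail (K : fieldType) m n (S : {set 'I_m * 'I_n}) : Prop :=
  [/\ ~ gen_by_quadratic_binomials (I_S (K:=K) S),
      ~ has_squarefree_initial_ideal (I_S (K:=K) S),
      ~ has_quadratic_groebner_basis (I_S (K:=K) S),
      ~ normal_subring (R_S (K:=K) S) &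
      ~ koszul_ring (R_S (K:=K) S) (R_S1 (K:=K) S) (R_Splus (K:=K) S)].

(** The abstract [row], [col] and [s] cover [S], its complement and the transposes of both, while
    the ring remains that of [S]. *)
Lemma pattern_fails (K : fieldType) m n (Hn : (0 < n)%N) (S : {set 'I_m * 'I_n})
    (A B : eqType) (row : 'I_(m * n) -> A) (col : 'I_(m * n) -> B)
    (cell : A -> B -> 'I_(m * n)) (s : pred 'I_(m * n)) (r1 r2 : A) (k1 k2 k3 : B) :
  (forall a b, toric_exp (gen_exp Hn S) a = toric_exp (gen_exp Hn S) b <->
    same_margins row col s a b) ->
  (forall i j, row (cell i j) = i) -> (forall i j, col (cell i j) = j) ->
  (forall x, cell (row x) (col x) = x) ->
  [/\ s (cell r1 k1), ~~ s (cell r1 k2) & ~~ s (cell r1 k3)] ->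
  [/\ ~~ s (cell r2 k1), s (cell r2 k2) & ~~ s (cell r2 k3)] ->
  all_conditions_fail K S.
Proof.
move=> fib rowE colE cellE s1 s2.
have inj x y : row x = row y -> col x = col y -> x = y.
  by move=> h1 h2; rewrite -(cellE x) -(cellE y) h1 h2.
have r12 : r1 != r2.
  by apply/eqP => r12; case: s1 s2 => + _ _ [+ _ _]; rewrite r12 => ->.
have k12 : k1 != k2.
  by apply/eqP => k12; case: s1 => + + _; rewrite k12 => ->.
have k13 : k1 != k3.
  by apply/eqP => k13; case: s1 => + _; rewrite k13 => ->.
have k23 : k2 != k3.
  by apply/eqP => k23; case: s2 => _ +; rewrite k23 => ->.
have R i : [/\ row (cell i k1) = i, row (cell i k2) = i & row (cell i k3) = i].
  by split; apply: rowE.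
have C j : col (cell r1 j) = j /\ col (cell r2 j) = j by split; apply: colE.
have C' j : col (cell r2 j) = j /\ col (cell r1 j) = j by split; apply: colE.
have R' i : [/\ row (cell i k2) = i, row (cell i k1) = i & row (cell i k3) = i].
  by split; apply: rowE.
have s1' : [/\ ~~ s (cell r1 k2), s (cell r1 k1) & ~~ s (cell r1 k3)] by case: s1.
have s2' : [/\ s (cell r2 k2), ~~ s (cell r2 k1) & ~~ s (cell r2 k3)] by case: s2.
have k21 : k2 != k1 by rewrite eq_sym.
have r21 : r2 != r1 by rewrite eq_sym.
pose M0 := pattern_mon (cell r1 k1) (cell r1 k2) (cell r2 k3).
(* Exchanging the two rows together with the first two columns preserves the pattern, so [M1] is
   again a pattern monomial and the same lemma serves both fibres. *)
pose M1 := pattern_mon (cell r2 k2) (cell r2 k1) (cell r1 k3).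
have sing0 b b' : (b <= M0)%MM -> b != M0 ->
    toric_exp (gen_exp Hn S) b' = toric_exp (gen_exp Hn S) b -> b' = b.
  move=> bM bn /fib.
  exact: (pattern_mon_singleton inj r12 k12 k13 k23 (R r1) (R r2) (C k1) (C k2) (C k3) s1 s2 bM bn).
have sing1 b b' : (b <= M1)%MM -> b != M1 ->
    toric_exp (gen_exp Hn S) b' = toric_exp (gen_exp Hn S) b -> b' = b.
  move=> bM bn /fib.
  exact: (pattern_mon_singleton inj r21 k21 k23 k13 (R' r2) (R' r1) (C' k2) (C' k1) (C' k3) s2' s1' bM bn).
have M1E : M1 = (U_(cell r2 k1) + U_(cell r2 k2) + (U_(cell r1 k3) + U_(cell r1 k3)))%MM.
  by rewrite /M1 /pattern_mon; mnm_lia.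
have U := six_uniq r12 k12 k13 k23 (R r1) (R r2) (C k1) (C k2) (C k3).
have eqM : toric_exp (gen_exp Hn S) M0 = toric_exp (gen_exp Hn S) M1.
  have out0 x : x \notin _ -> M0 x = 0%N := @pattern_mon_six _ _ _ (cell r1 k3) (cell r2 k1) (cell r2 k2) _ x.
  have out1 x : x \notin [:: cell r1 k1; cell r1 k2; cell r1 k3; cell r2 k1; cell r2 k2; cell r2 k3] ->
      M1 x = 0%N.
    move=> xs; apply: (@pattern_mon_six _ _ _ (cell r2 k3) (cell r1 k2) (cell r1 k1)).
    by apply: contra xs; rewrite !inE; do ![case/orP]; move=> ->; rewrite ?orbT.
  apply/fib; apply: (pattern_margins r12 k12 k13 k23 (R r1) (R r2) (C k1) (C k2) (C k3) s1 s2 out0 out1).2.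
  move: U; rewrite M1E /M0 /pattern_mon /= !inE !negb_or => /and5P[].
  move=> /and5P[n1 n2 n3 n4 n5] /and4P[n6 n7 n8 n9] /and3P[n10 n11 n12] /andP[n13 n14] /andP[n15 _].
  have nn (x y : 'I_(m * n)) (h : x != y) : ((x == y) = false) * ((y == x) = false).
    by rewrite [y == x]eq_sym (negbTE h).
  rewrite !mnmDE !mnm1E !eqxx ?(nn _ _ n1, nn _ _ n2, nn _ _ n3, nn _ _ n4, nn _ _ n5, nn _ _ n6,
    nn _ _ n7, nn _ _ n8, nn _ _ n9, nn _ _ n10, nn _ _ n11, nn _ _ n12, nn _ _ n13, nn _ _ n14, nn _ _ n15).
  by [].
have c13 : cell r1 k3 \notin [:: cell r1 k1; cell r1 k2; cell r2 k3].
  move: U; rewrite /= !inE !negb_or => /and5P[].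
  move=> /and5P[n1 n2 n3 n4 n5] /and4P[n6 n7 n8 n9] /and3P[n10 n11 n12] _ _.
  by rewrite ![cell r1 k3 == cell r1 _]eq_sym n2 n6 n12.
rewrite M1E in sing1 eqM.
have gE := gens_SE Hn S K.
split.
- exact: (not_gen_by_quadratic_binomials gE sing0 eqM c13).
- exact: (no_squarefree_initial_ideal gE sing0 sing1 eqM c13).
- exact: (no_quadratic_groebner_basis gE sing0 sing1 eqM c13).
- exact: (not_normal gE sing0 eqM c13).
exact: (not_koszul gE sing0 eqM c13).
Qed.

(** * Permutations and the dichotomy on [S] *)

Lemma perm_of_seq m (l : seq 'I_m) : uniq l -> (forall i, i \in l) ->
  exists s : 'S_m, forall i, s i = index i l :> nat.
Proof.
move=> lu li.
have sz : size l = m.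
  rewrite -[RHS]card_ord -(card_uniqP lu); apply: eq_card => i.
  by rewrite li.
have lt i : (index i l < m)%N by rewrite -[X in (_ < X)%N]sz index_mem.
have inj : injective (fun i => Ordinal (lt i)).
  by move=> i j [/(congr1 (nth i l))]; rewrite !nth_index.
by exists (perm inj) => i; rewrite permE.
Qed.

Lemma sorting_perm m (f : 'I_m -> nat) :
  exists s : 'S_m, forall i i', (s i' <= s i)%N -> (f i <= f i')%N.
Proof.
pose leT x y := (f y <= f x)%N.
have tot : total leT by move=> x y; apply: leq_total.
have tr : transitive leT by move=> x y z h1 h2; apply: leq_trans h2 h1.
have [|i|s sE] := @perm_of_seq m (sort leT (enum 'I_m)).
- by rewrite sort_uniq enum_uniq.
- by rewrite mem_sort mem_enum.
exists s => i i'; rewrite !sE => h.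
apply: (sorted_leq_index tr _ (sort_sorted tot (enum 'I_m))) h; rewrite ?mem_sort ?mem_enum //.
by move=> x; apply: leqnn.
Qed.

Lemma partition_perm m (A : {pred 'I_m}) :
  exists s : 'S_m, forall i, (s i < #|A|)%N = (i \in A).
Proof.
have mem_l (B : {pred 'I_m}) i : (i \in enum B) = (i \in B) by rewrite mem_enum.
have [|i|s sE] := @perm_of_seq m (enum A ++ enum [predC A]).
- rewrite cat_uniq !enum_uniq andbT /=; apply/hasPn => i.
  by rewrite !mem_l inE.
- by rewrite mem_cat !mem_l inE orbN.
exists s => i; rewrite sE index_cat mem_l cardE; case: ifP => iA.
  by rewrite index_mem mem_l.
by rewrite ltnNge leq_addr.
Qed.

(** Without a 2 x 2 diagonal pattern the rows, as sets of columns, form a chain, and so do the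
    columns; sorting by size gives a triangle. With one, either a third line takes equal values on
    it, or every line is forced and [S] has two blocks. *)
Lemma pattern_or_shape m n (S : {set 'I_m * 'I_n}) :
  [\/ exists i k j l p, [/\ (i, j) \in S, (i, l) \notin S, (k, j) \notin S, (k, l) \in S &
        ((i, p) \in S) = ((k, p) \in S)],
      exists i k p j l, [/\ (i, j) \in S, (i, l) \notin S, (k, j) \notin S, (k, l) \in S &
        ((p, j) \in S) = ((p, l) \in S)],
      block_diagonal_2x2 S | triangular S].
Proof.
pose diag i k j l := [&& (i, j) \in S, (i, l) \notin S, (k, j) \notin S & (k, l) \in S].
have [/existsP[i /existsP[k /existsP[j /existsP[l /and4P[ij il kj kl]]]]]|nd] :=
  boolP [exists i, exists k, exists j, exists l, diag i k j l]; last first.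
  have nodiag i k j l : (i, j) \in S -> (i, l) \notin S -> (k, j) \notin S -> (k, l) \in S -> False.
    move=> h1 h2 h3 h4; case/negP: nd; apply/existsP; exists i; apply/existsP; exists k.
    by apply/existsP; exists j; apply/existsP; exists l; apply/and4P.
  constructor 4.
  have [s sE] := sorting_perm (fun i => #|[set j | (i, j) \in S]|).
  have [s' sE'] := sorting_perm (fun j => #|[set i | (i, j) \in S]|).
  exists s, s' => i j i' j' ij /sE ii /sE' jj.
  have i'j : (i', j) \in S.
    apply: contraT => ni'j; move: ii; rewrite leqNgt => /negP[]; apply: proper_card.
    apply/properP; split; last by exists j; rewrite inE.
    apply/subsetP => l; rewrite !inE => i'l; apply: contraT => il.
    by case: (nodiag i i' j l).
  apply: contraT => ni'j'; move: jj; rewrite leqNgt => /negP[]; apply: proper_card.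
  apply/properP; split; last by exists i'; rewrite inE.
  apply/subsetP => k; rewrite !inE => kj'; apply: contraT => kj.
  by case: (nodiag i' k j j').
have [/existsP[/= p1 /existsP[p2 /existsP[q1 /existsP[q2 /existsP[p /andP[/and4P[h1 h2 h3 h4] /eqP h5]]]]]]|np] :=
  boolP [exists i, exists k, exists j, exists l, exists p, diag i k j l && (((i, p) \in S) == ((k, p) \in S))].
  by constructor 1; exists p1, p2, q1, q2, p.
have [/existsP[p /eqP hp]|np'] := boolP [exists p, ((p, j) \in S) == ((p, l) \in S)].
  by constructor 2; exists i, k, p, j, l.
have compl a b j' l' p : diag a b j' l' -> ((a, p) \in S) = ~~ ((b, p) \in S).
  move=> dg; have [e|] := eqVneq ((a, p) \in S) ((b, p) \in S); last by case: (_ \in _); case: (_ \in _).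
  case/negP: np; apply/existsP; exists a; apply/existsP; exists b; apply/existsP; exists j'.
  by apply/existsP; exists l'; apply/existsP; exists p; rewrite dg e eqxx.
have ik p : ((i, p) \in S) = ~~ ((k, p) \in S) by apply: (compl _ _ j l); rewrite /diag ij il kj kl.
(* Row [r] forms a diagonal pattern with row [k] or with row [i]; accordingly it equals row [i] or
   is its complement. *)
have SE r p : ((r, p) \in S) = (((r, j) \in S) == ((i, p) \in S)).
  have : ((r, j) \in S) != ((r, l) \in S).
    by apply: contraNN np' => h; apply/existsP; exists r.
  case rj : ((r, j) \in S); case rl : ((r, l) \in S) => // _.
    by rewrite (compl r k j l) ?ik ?negbK; [case: (_ \in _) | rewrite /diag rj rl kj kl].
  have := compl i r j l p; rewrite /diag ij il rj rl => /(_ isT) ->.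
  by case: (_ \in _).
constructor 3.
have [s sE] := partition_perm [pred r | (r, j) \in S].
have [s' sE'] := partition_perm [pred p | (i, p) \in S].
exists s, s', #|[pred r | (r, j) \in S]|, #|[pred p | (i, p) \in S]| => r p.
rewrite [in X in _ <-> X](leqNgt _ (s r)) (leqNgt _ (s' p)) sE sE' !inE SE.
case: (_ \in _); case: (_ \in _); split=> //=; [by left | by case=> -[] | by case=> -[] | by right].
Qed.

(** * Tables supported on chains *)

Lemma cnt_split N (a : 'X_{1..N}) (Q R : pred 'I_N) :
  cnt a Q = (cnt a [pred x | Q x && R x] + cnt a [pred x | Q x && ~~ R x])%N.
Proof. exact: bigID. Qed.

Lemma eq_cnt N (a : 'X_{1..N}) (Q R : pred 'I_N) : Q =1 R -> cnt a Q = cnt a R.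
Proof. exact: eq_bigl. Qed.

Lemma cnt_gt0P N (a : 'X_{1..N}) (Q : pred 'I_N) :
  reflect (exists2 x, Q x & (0 < a x)%N) (0 < cnt a Q)%N.
Proof.
rewrite lt0n /cnt sum_nat_eq0 negb_forall.
apply: (iffP existsP) => [[x p]|[x Qx ax]]; exists x; rewrite ?negb_imply ?Qx -?lt0n //.
- by move: p; rewrite negb_imply => /andP[].
- by move: p; rewrite negb_imply -lt0n => /andP[].
Qed.

Lemma cnt_fiber N (a : 'X_{1..N}) (A : finType) (f : 'I_N -> A) (Q : pred A) :
  cnt a [pred x | Q (f x)] = (\sum_(i | Q i) cnt a [pred x | f x == i])%N.
Proof.
rewrite /cnt (partition_big f Q) //; apply: eq_bigr => i Qi; apply: eq_bigl => x /=.
by case: eqP => [->|]; rewrite ?Qi ?andbF.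
Qed.

Lemma cntD N (a b : 'X_{1..N}) Q : cnt (a + b)%MM Q = (cnt a Q + cnt b Q)%N.
Proof. by rewrite /cnt -big_split; apply: eq_bigr => x _; rewrite mnmDE. Qed.

Lemma cnt1 N x Q : cnt (U_(x)%MM : 'X_{1..N}) Q = Q x.
Proof.
rewrite /cnt; case Qx: (Q x); last first.
  rewrite big1 // => y Qy; rewrite mnm1E; case: eqP => // xy.
  by rewrite xy Qy in Qx.
rewrite (bigD1 x) //= mnm1E eqxx big1 // => y /andP[_ yx].
by rewrite mnm1E eq_sym (negbTE yx).
Qed.

Section Chains.
Variables (N : nat) (al be : 'I_N -> nat) (T : pred 'I_N).
Hypothesis cell_inj : forall x y, al x = al y -> be x = be y -> x = y.

Definition chain_on (a : 'X_{1..N}) := forall x y, T x -> T y -> (0 < a x)%N -> (0 < a y)%N ->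
  ~~ ((al x < al y) && (be y < be x))%N.

(** On a chain a corner and the opposite corner cannot both be occupied. Their difference is fixed
    by the margins, so truncated subtraction returns the corner itself. *)
Lemma chain_corner a p q : chain_on a ->
  cnt a [pred x | [&& T x, (al x < p)%N & (q <= be x)%N]] =
  (cnt a [pred x | T x && (al x < p)%N] + cnt a [pred x | T x && (q <= be x)%N] - cnt a T)%N.
Proof.
move=> ch; set F := cnt a _.
have e1 := cnt_split a [pred x | T x && (al x < p)%N] [pred x | (q <= be x)%N].
have e2 := cnt_split a [pred x | T x && (q <= be x)%N] [pred x | (al x < p)%N].
have e3 := cnt_split a T [pred x | (al x < p)%N].
have e4 := cnt_split a [pred x | T x && ~~ (al x < p)%N] [pred x | (q <= be x)%N].
have f1 : cnt a [pred x | (T x && (al x < p)%N) && (q <= be x)%N] = F.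
  by apply: eq_cnt => x /=; rewrite -andbA.
have f2 : cnt a [pred x | (T x && (q <= be x)%N) && (al x < p)%N] = F.
  by apply: eq_cnt => x /=; rewrite -andbA [(_ <= _)%N && _]andbC.
have f3 : cnt a [pred x | (T x && ~~ (al x < p)%N) && (q <= be x)%N] =
    cnt a [pred x | (T x && (q <= be x)%N) && ~~ (al x < p)%N].
  by apply: eq_cnt => x /=; rewrite -!andbA [(_ <= _)%N && _]andbC.
set G := cnt a [pred x | (T x && ~~ (al x < p)%N) && ~~ (q <= be x)%N] in e4.
have FG : F = 0%N \/ G = 0%N.
  have [F0|/cnt_gt0P[x /= /and3P[Tx xp xq] ax]] := posnP F; first by left.
  have [G0|/cnt_gt0P[y /= /andP[/andP[Ty yp] yq] ay]] := posnP G; first by right.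
  have := ch x y Tx Ty ax ay; move: xp xq yp yq; clear; lia.
move: e1 e2 e3 e4 f1 f2 f3 FG; rewrite /=; clear; lia.
Qed.

(** A cell is a second difference of corner counts, written here without subtraction. *)
Lemma cell_of_corners (a : 'X_{1..N}) x : T x ->
  (a x + cnt a [pred y | [&& T y, (al y < al x)%N & (be x <= be y)%N]] +
     cnt a [pred y | [&& T y, (al y < (al x).+1)%N & ((be x).+1 <= be y)%N]] =
   cnt a [pred y | [&& T y, (al y < (al x).+1)%N & (be x <= be y)%N]] +
     cnt a [pred y | [&& T y, (al y < al x)%N & ((be x).+1 <= be y)%N]])%N.
Proof.
move=> Tx.
have e1 := cnt_split a [pred y | [&& T y, (al y < (al x).+1)%N & (be x <= be y)%N]]
  [pred y | (al y < al x)%N].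
have e2 := cnt_split a [pred y | [&& T y, (al y < (al x).+1)%N & ((be x).+1 <= be y)%N]]
  [pred y | (al y < al x)%N].
have e3 := cnt_split a [pred y | [&& T y, al y == al x & (be x <= be y)%N]]
  [pred y | ((be x).+1 <= be y)%N].
have f1 : cnt a [pred y | [&& T y, (al y < (al x).+1)%N & (be x <= be y)%N] && (al y < al x)%N] =
    cnt a [pred y | [&& T y, (al y < al x)%N & (be x <= be y)%N]].
  by apply: eq_cnt => y /=; case: (T y) => //=; clear; lia.
have f2 : cnt a [pred y | [&& T y, (al y < (al x).+1)%N & (be x <= be y)%N] && ~~ (al y < al x)%N] =
    cnt a [pred y | [&& T y, al y == al x & (be x <= be y)%N]].
  by apply: eq_cnt => y /=; case: (T y) => //=; clear; lia.
have f3 : cnt a [pred y | [&& T y, (al y < (al x).+1)%N & ((be x).+1 <= be y)%N] && (al y < al x)%N] =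
    cnt a [pred y | [&& T y, (al y < al x)%N & ((be x).+1 <= be y)%N]].
  by apply: eq_cnt => y /=; case: (T y) => //=; clear; lia.
have f4 : cnt a [pred y | [&& T y, (al y < (al x).+1)%N & ((be x).+1 <= be y)%N] && ~~ (al y < al x)%N] =
    cnt a [pred y | [&& T y, al y == al x & (be x <= be y)%N] && ((be x).+1 <= be y)%N].
  by apply: eq_cnt => y /=; case: (T y) => //=; clear; lia.
have f5 : cnt a [pred y | [&& T y, al y == al x & (be x <= be y)%N] && ~~ ((be x).+1 <= be y)%N] = a x.
  rewrite /cnt (big_pred1 x) // => y /=; apply/idP/eqP => [|->]; last by rewrite Tx eqxx ltnn leqnn.
  move=> /andP[/and3P[_ /eqP e h1] h2]; apply: cell_inj => //.
  by apply/eqP; rewrite eqn_leq h1 andbT leqNgt.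
move: e1 e2 e3 f1 f2 f3 f4 f5; rewrite /=; clear; lia.
Qed.

Lemma chain_unique (a b : 'X_{1..N}) : chain_on a -> chain_on b -> cnt a T = cnt b T ->
  (forall p, cnt a [pred x | T x && (al x < p)%N] = cnt b [pred x | T x && (al x < p)%N]) ->
  (forall q, cnt a [pred x | T x && (q <= be x)%N] = cnt b [pred x | T x && (q <= be x)%N]) ->
  forall x, T x -> a x = b x.
Proof.
move=> cha chb eT eA eB x Tx; have := cell_of_corners a Tx; have := cell_of_corners b Tx.
by rewrite !chain_corner // eT !eA !eB; clear; lia.
Qed.

End Chains.

(** * Nested arcs *)

Section IdealGen.
Variables (K : fieldType) (N : nat).
Implicit Types (G H : {mpoly K[N]} -> Prop) (p q : {mpoly K[N]}).

Lemma ideal_gen0 G : ideal_gen G 0.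
Proof. by exists [::]; rewrite big_nil. Qed.

Lemma ideal_gen_in G q : G q -> ideal_gen G q.
Proof.
move=> Gq; exists [:: (1, q)]; split=> [x|]; last by rewrite big_seq1 mul1r.
by rewrite inE => /eqP->.
Qed.

Lemma ideal_genD G p q : ideal_gen G p -> ideal_gen G q -> ideal_gen G (p + q).
Proof.
move=> [s [sG ->]] [s' [sG' ->]]; exists (s ++ s'); rewrite big_cat; split=> // x.
by rewrite mem_cat => /orP[/sG|/sG'].
Qed.

Lemma ideal_genM G p q : ideal_gen G q -> ideal_gen G (p * q).
Proof.
move=> [s [sG ->]]; exists [seq (p * x.1, x.2) | x <- s]; split=> [_ /mapP[x /sG Gx ->]//|].
by rewrite big_map mulr_sumr; apply: eq_bigr => x _; rewrite mulrA.
Qed.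

Lemma ideal_gen_sub G H p : (forall q, G q -> ideal_gen H q) -> ideal_gen G p -> ideal_gen H p.
Proof.
move=> GH [s [sG ->]]; rewrite big_seq; apply: (big_ind (ideal_gen H)) => [|q q'|x xs].
- exact: ideal_gen0.
- exact: ideal_genD.
by apply: ideal_genM; apply: GH; apply: sG.
Qed.

End IdealGen.

Section Threshold.
Variables (m n : nat) (Hn : (0 < n)%N) (S : {set 'I_m * 'I_n}).
Variables (a : 'I_m -> nat) (b : 'I_n -> nat) (L : nat).
Hypotheses (a_inj : injective a) (b_inj : injective b).
Hypotheses (aL : forall i, (a i < L)%N) (bL : forall j, (b j < L)%N).
Hypothesis ab : forall i j, a i <> b j.
Hypothesis SE : forall i j, ((i, j) \in S) = (b j < a i)%N.

Local Notation N := (m * n)%N.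
Local Notation row := (row_of Hn).
Local Notation col := (col_of Hn).
Local Notation inS := (in_S Hn S).
Local Notation phi := (toric_exp (gen_exp Hn S)).

(* Rows and columns are points of a circle of length [L], and the cell [x] is the
   arc from [arc_start x] clockwise to its column point; the arcs through the base
   point 0 are exactly the cells of [S]. *)
Definition arc_start (x : 'I_N) : nat := a (row x).
Definition arc_end (x : 'I_N) : nat := (b (col x) + (if inS x then L else 0))%N.
Definition arc_weight (x : 'I_N) : nat := ((arc_end x - arc_start x) ^ 2)%N.

(** Arcs are compared on the line that covers the circle. The second alternative is nesting of the
    translate of [y] by [L]; its condition on the starts is automatic because starts are below
    [L]. *)
Definition nested (x y : 'I_N) : bool :=
  ((arc_start x < arc_start y) && (arc_end y < arc_end x))%N || (arc_end y + L < arc_end x)%N.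

Lemma inSE x : inS x = (b (col x) < a (row x))%N.
Proof. by rewrite /in_S SE. Qed.

Lemma nested_irr x : nested x x = false.
Proof. by rewrite /nested !ltnn /=; apply/negbTE; rewrite -leqNgt leq_addr. Qed.

Lemma nestedE x y : nested x y =
  if inS x == inS y then ((a (row x) < a (row y)) && (b (col y) < b (col x)))%N
  else inS x && ((a (row x) < a (row y)) || (b (col y) < b (col x)))%N.
Proof.
rewrite /nested /arc_start /arc_end !inSE.
move: (aL (row x)) (aL (row y)) (bL (col x)) (bL (col y)) (@ab (row x) (col x)) (@ab (row y) (col y)); clear.
by have [h1|h1] := ltnP (b (col x)) (a (row x)); have [h2|h2] := ltnP (b (col y)) (a (row y)) => /=; lia.
Qed.

Definition swap (x y : 'I_N) : 'I_N := cell_of Hn (row x) (col y).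

Lemma row_swap x y : row (swap x y) = row x. Proof. exact: cell_ofK1. Qed.
Lemma col_swap x y : col (swap x y) = col y. Proof. exact: cell_ofK2. Qed.

Lemma swap_inS x y : nested x y -> (inS (swap x y) + inS (swap y x) = inS x + inS y)%N.
Proof.
rewrite nestedE !inSE !row_swap !col_swap.
move: (@ab (row x) (col x)) (@ab (row y) (col y)); clear.
have [h1|h1] := ltnP (b (col x)) (a (row x)); have [h2|h2] := ltnP (b (col y)) (a (row y));
  have [h3|h3] := ltnP (b (col y)) (a (row x)); have [h4|h4] := ltnP (b (col x)) (a (row y)) => //=; lia.
Qed.

Lemma swap_weight x y : nested x y ->
  (arc_weight (swap x y) + arc_weight (swap y x) < arc_weight x + arc_weight y)%N.
Proof.
move=> xy; rewrite /arc_weight.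
have [lx [ly [lx' [ly' [-> -> -> -> [e h1 h2]]]]]] : exists lx ly lx' ly',
    [/\ arc_end x - arc_start x = lx, arc_end y - arc_start y = ly,
        arc_end (swap x y) - arc_start (swap x y) = lx', arc_end (swap y x) - arc_start (swap y x) = ly' &
        [/\ lx + ly = lx' + ly', ly < lx' & lx' < lx]]%N.
  do 4![eexists]; split; try reflexivity; move: xy.
  rewrite nestedE /arc_start /arc_end !inSE !row_swap !col_swap.
  move: (@ab (row x) (col x)) (@ab (row y) (col y)) (@ab (row x) (col y)) (@ab (row y) (col x)).
  move: (aL (row x)) (aL (row y)) (bL (col x)) (bL (col y)); clear.
  have [h1|h1] := ltnP (b (col x)) (a (row x)); have [h2|h2] := ltnP (b (col y)) (a (row y));
  have [h3|h3] := ltnP (b (col y)) (a (row x)); have [h4|h4] := ltnP (b (col x)) (a (row y)) => //=;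
  by split; lia.
(* With [d = lx' - ly] the sum of squares drops by [2 d (ly' - ly)]. *)
have [d [e1 e2 d0 l0]] : exists d, [/\ lx' = ly + d, lx = ly' + d, 0 < d & ly < ly']%N.
  by exists (lx' - ly)%N; move: e h1 h2; clear; split; lia.
have dl : (d * ly < d * ly')%N by rewrite ltn_pmul2l.
by rewrite e1 e2 -!mulnn !mulnDl !mulnDr; move: dl; clear; lia.
Qed.

Lemma swap_fibre x y : nested x y ->
  phi (U_(x) + U_(y))%MM = phi (U_(swap x y) + U_(swap y x))%MM.
Proof.
move=> xy; apply/same_marginsP; have := swap_inS xy.
split=> [i|j||]; rewrite !cntD !cnt1 /= ?row_swap ?col_swap //; first exact: addnC.
by move: (inS _) (inS _) (inS _) (inS _) H; do 4![case] => //=.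
Qed.

Definition mon_weight (c : 'X_{1..N}) : nat := (\sum_x c x * arc_weight x)%N.

Lemma mon_weightD c d : mon_weight (c + d)%MM = (mon_weight c + mon_weight d)%N.
Proof.
by rewrite /mon_weight -big_split; apply: eq_bigr => x _; rewrite mnmDE mulnDl.
Qed.

Lemma mon_weight1 x : mon_weight U_(x)%MM = arc_weight x.
Proof.
rewrite /mon_weight (bigD1 x) //= mnm1E eqxx mul1n big1 ?addn0 // => y yx.
by rewrite mnm1E eq_sym (negbTE yx) mul0n.
Qed.

Definition arc_lt (c d : 'X_{1..N}) : bool :=
  (mon_weight c < mon_weight d)%N || (mon_weight c == mon_weight d) && (c < d)%O.

Lemma arc_lt_order : monomial_order arc_lt.
Proof.
split=> [c|d c e|c d cd|c d e|c c0]; rewrite /arc_lt.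
- by rewrite ltnn ltxx andbF.
- move=> /orP[h1|/andP[/eqP h1 o1]] /orP[h2|/andP[/eqP h2 o2]].
  + by rewrite (ltn_trans h1 h2).
  + by rewrite -h2 h1.
  + by rewrite h1 h2.
  by rewrite h1 h2 eqxx (lt_trans o1 o2) orbT.
- case: ltngtP => //= _; by rewrite -neq_lt.
- by rewrite !mon_weightD ltn_add2r eqn_add2r ltmc_add2l.
have -> : mon_weight 0%MM = 0%N by rewrite /mon_weight big1 // => x _; rewrite mnm0E.
rewrite eq_sym; case: posnP => //= _; rewrite lt_neqAle eq_sym c0 /=.
by rewrite -[X in (_ <= X)%O]add0m lemc_addr.
Qed.

Definition sorted_mon (c : 'X_{1..N}) : Prop :=
  forall x y, (0 < c x)%N -> (0 < c y)%N -> ~~ nested x y.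

Lemma cell_pos_inj x y : a (row x) = a (row y) -> b (col x) = b (col y) -> x = y.
Proof. by move=> /a_inj h1 /b_inj h2; rewrite -(row_col_ofK Hn x) -(row_col_ofK Hn y) h1 h2. Qed.

Lemma sorted_chain c : sorted_mon c ->
  chain_on (fun x => a (row x)) (fun x => b (col x)) inS c /\
  chain_on (fun x => a (row x)) (fun x => b (col x)) (predC inS) c.
Proof.
move=> sc; split=> x y xS yS cx cy; have := sc x y cx cy; rewrite nestedE.
  by rewrite xS yS eqxx.
by rewrite (negbTE xS) (negbTE yS) eqxx.
Qed.

(* The arcs off [S] start at the first and end at the last points of the margins. *)
Lemma sorted_starts c p : sorted_mon c ->
  cnt c [pred x | predC inS x && (a (row x) < p)%N] =
  minn (cnt c [pred x | (a (row x) < p)%N]) (cnt c (predC inS)).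
Proof.
move=> sc; have e1 := cnt_split c [pred x | (a (row x) < p)%N] (predC inS).
have e2 := cnt_split c (predC inS) [pred x | (a (row x) < p)%N].
have f1 : cnt c [pred x | (a (row x) < p)%N && predC inS x] =
    cnt c [pred x | predC inS x && (a (row x) < p)%N].
  by apply: eq_cnt => x /=; rewrite andbC.
set B := cnt c [pred x | _ && ~~ predC inS x] in e1.
set A := cnt c [pred x | predC inS x && ~~ _] in e2.
have AB : A = 0%N \/ B = 0%N.
  have [A0|/cnt_gt0P[y /= /andP[yS yp] cy]] := posnP A; first by left.
  have [B0|/cnt_gt0P[x /= /andP[xp xS] cx]] := posnP B; first by right.
  have := sc x y cx cy; rewrite nestedE (negbTE yS); rewrite negbK in xS; rewrite xS /=.
  by move: xp yp; clear; lia.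
by move: e1 e2 f1 AB; rewrite /=; clear; lia.
Qed.

Lemma sorted_ends c q : sorted_mon c ->
  cnt c [pred x | predC inS x && (q <= b (col x))%N] =
  minn (cnt c [pred x | (q <= b (col x))%N]) (cnt c (predC inS)).
Proof.
move=> sc; have e1 := cnt_split c [pred x | (q <= b (col x))%N] (predC inS).
have e2 := cnt_split c (predC inS) [pred x | (q <= b (col x))%N].
have f1 : cnt c [pred x | (q <= b (col x))%N && predC inS x] =
    cnt c [pred x | predC inS x && (q <= b (col x))%N].
  by apply: eq_cnt => x /=; rewrite andbC.
set B := cnt c [pred x | _ && ~~ predC inS x] in e1.
set A := cnt c [pred x | predC inS x && ~~ _] in e2.
have AB : A = 0%N \/ B = 0%N.
  have [A0|/cnt_gt0P[y /= /andP[yS yp] cy]] := posnP A; first by left.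
  have [B0|/cnt_gt0P[x /= /andP[xp xS] cx]] := posnP B; first by right.
  have := sc x y cx cy; rewrite nestedE (negbTE yS); rewrite negbK in xS; rewrite xS /=.
  by move: xp yp; clear; lia.
by move: e1 e2 f1 AB; rewrite /=; clear; lia.
Qed.

(** The margins fix the starts and ends of the arcs off [S], hence by subtraction those of the arcs
    in [S]. Each of the two classes is a chain, so its cells are determined. *)
Lemma sorted_unique c d : sorted_mon c -> sorted_mon d -> phi c = phi d -> c = d.
Proof.
move=> sc sd /same_marginsP[hr hc hS hT].
have eA p : cnt c [pred x | (a (row x) < p)%N] = cnt d [pred x | (a (row x) < p)%N].
  by rewrite !(cnt_fiber _ row (fun i => (a i < p)%N)); apply: eq_bigr => i _.
have eB q : cnt c [pred x | (q <= b (col x))%N] = cnt d [pred x | (q <= b (col x))%N].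
  by rewrite !(cnt_fiber _ col (fun j => (q <= b j)%N)); apply: eq_bigr => j _.
have nA p : cnt c [pred x | predC inS x && (a (row x) < p)%N] =
    cnt d [pred x | predC inS x && (a (row x) < p)%N].
  by rewrite !sorted_starts // eA hT.
have nB q : cnt c [pred x | predC inS x && (q <= b (col x))%N] =
    cnt d [pred x | predC inS x && (q <= b (col x))%N].
  by rewrite !sorted_ends // eB hT.
have comp (f : 'X_{1..N}) (R : pred 'I_N) :
    cnt f R = (cnt f [pred x | predC inS x && R x] + cnt f [pred x | inS x && R x])%N.
  rewrite (cnt_split f R (predC inS)); congr (_ + _)%N; apply: eq_cnt => x /=; first exact: andbC.
  by rewrite negbK andbC.
have [[c1 c2] [d1 d2]] := (sorted_chain sc, sorted_chain sd).
apply/mnmP => x; have [xS|xS] := boolP (inS x).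
  apply: (chain_unique cell_pos_inj c1 d1 hS _ _ xS) => [p|q].
    have := eA p; rewrite (comp c) (comp d); move: (nA p); rewrite /=; clear; lia.
  have := eB q; rewrite (comp c) (comp d); move: (nB q); rewrite /=; clear; lia.
exact: (chain_unique cell_pos_inj c2 d2 hT nA nB xS).
Qed.

Lemma sorted_or_nested c :
  sorted_mon c \/ exists x y, nested x y /\ (U_(x) + U_(y) <= c)%MM.
Proof.
have [/existsP[x /existsP[y /and3P[cx cy xy]]]|nex] :=
    boolP [exists x, exists y, [&& (0 < c x)%N, (0 < c y)%N & nested x y]].
  right; exists x, y; split=> //; apply/mnm_lepP => z; rewrite mnmDE !mnm1E.
  have [xz|_] := eqVneq x z; have [yz|_] := eqVneq y z => //.
    by move: xy; rewrite xz yz nested_irr.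
  - by rewrite -xz.
  by rewrite -yz.
left=> x y cx cy; apply: contra nex => xy; apply/existsP; exists x; apply/existsP; exists y.
by rewrite cx cy.
Qed.

Section Ideal.
Variable K : fieldType.
Local Notation P := {mpoly K[N]}.
Local Notation I := (I_S (K:=K) S).
Let gE := gens_SE Hn S K.

Definition swap_binomial (x y : 'I_N) : P :=
  'X_[U_(x) + U_(y)] - 'X_[U_(swap x y) + U_(swap y x)].

Lemma swap_binomial_in x y : nested x y -> I (swap_binomial x y).
Proof. by move=> xy; apply: (toric_ker_binomial gE); apply: swap_fibre. Qed.

Lemma swap_lt x y : nested x y ->
  arc_lt (U_(swap x y) + U_(swap y x))%MM (U_(x) + U_(y))%MM.
Proof. by move=> xy; rewrite /arc_lt !mon_weightD !mon_weight1 swap_weight. Qed.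

Lemma swap_neq x y : nested x y ->
  (U_(x) + U_(y))%MM != (U_(swap x y) + U_(swap y x))%MM.
Proof. by move/swap_lt; apply: contraTneq => <-; rewrite (mo_irr arc_lt_order). Qed.

Lemma swap_binomial_homog x y : swap_binomial x y \is 2.-homog.
Proof. by apply: rpredB; rewrite dhomogX /= mdegD !mdeg1. Qed.

Lemma swap_binomial_lead x y : nested x y ->
  is_initial_mon arc_lt (swap_binomial x y) (U_(x) + U_(y))%MM.
Proof.
move=> xy; have sn := swap_neq xy; split=> [|c]; rewrite mcoeff_msupp mcoeffB !mcoeffX.
  by rewrite eqxx [(_ + _ == U_(x) + _)%MM]eq_sym (negbTE sn) subr0 oner_neq0.
rewrite ![_ == c]eq_sym => + /negbTE cn; rewrite cn sub0r.
by have [-> _|_] := eqVneq c (U_(swap x y) + U_(swap y x))%MM; [apply: swap_lt | rewrite oppr0 eqxx].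
Qed.

Lemma swap_binomial_neq0 x y : nested x y -> swap_binomial x y != 0.
Proof. by case/swap_binomial_lead => + _; apply: contraTneq => ->; rewrite msupp0. Qed.

Definition quadrics (g : P) : Prop := exists x y, nested x y /\ g = swap_binomial x y.

Lemma sorted_reduction c : exists d,
  [/\ sorted_mon d, phi d = phi c, d = c \/ arc_lt d c & ideal_gen quadrics ('X_[c] - 'X_[d])].
Proof.
have [w] := ubnP (mon_weight c); elim: w c => // w IH c; rewrite ltnS => cw.
have [sc|[x [y [xy le]]]] := sorted_or_nested c.
  by exists c; split=> //; [left | rewrite subrr; apply: ideal_gen0].
pose e := (c - (U_(x) + U_(y)))%MM; have ce : c = (e + (U_(x) + U_(y)))%MM by rewrite submK.
pose c' := (e + (U_(swap x y) + U_(swap y x)))%MM.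
have lw : (mon_weight c' < mon_weight c)%N.
  by rewrite ce /c' !mon_weightD !mon_weight1 ltn_add2l swap_weight.
have [d [sd dc' dlt dI]] := IH c' (leq_trans lw cw); exists d; split=> //.
- by rewrite dc' ce /c' !(toric_expD _ e) (swap_fibre xy).
- have lt' : arc_lt c' c by rewrite /arc_lt lw.
  by right; case: dlt => [->//|/(mo_tr arc_lt_order)]; apply.
rewrite -(subrK 'X_[c'] 'X_[c]) -addrA; apply: ideal_genD => //.
have -> : 'X_[c] - 'X_[c'] = 'X_[e] * swap_binomial x y.
  by rewrite /swap_binomial mulrBr -!mpolyXD -ce.
by apply: ideal_genM; apply: ideal_gen_in; exists x, y.
Qed.

Lemma sorted_remainder (f : P) : exists p : P,
  ideal_gen quadrics (f - p) /\ {in msupp p, forall c, sorted_mon c}.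
Proof.
rewrite (mpolyE f).
apply: (big_ind (fun f => exists p : P, ideal_gen quadrics (f - p) /\
  {in msupp p, forall c, sorted_mon c})) => [|f1 f2 [p1 [h1 s1]] [p2 [h2 s2]]|c _].
- by exists 0; rewrite subrr; split; [apply: ideal_gen0 | move=> c; rewrite msupp0].
- exists (p1 + p2); rewrite opprD addrACA; split; first exact: ideal_genD.
  by move=> c /msuppD_le; rewrite mem_cat => /orP[/s1|/s2].
have [d [sd _ _ dI]] := sorted_reduction c; exists (f@_c *: 'X_[d]).
split; first by rewrite -scalerBr -mul_mpolyC; apply: ideal_genM.
by move=> c' /msuppZ_le; rewrite msuppX inE => /eqP->.
Qed.

(** The sorted remainder of [f] lies in [I], where every monomial needs a partner in its fibre; but
    no two sorted monomials share a fibre. *)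
Lemma quadrics_generate f : I f <-> ideal_gen quadrics f.
Proof.
have sub g : ideal_gen quadrics g -> I g.
  move=> [s [sG ->]]; rewrite /I_S /pi_S raddf_sum /= big1_seq // => q /andP[_ /sG[x [y [xy ->]]]].
  by rewrite rmorphM /= (swap_binomial_in xy : _ \mPo gens_S K S = 0) mulr0.
split=> [If|]; last exact: sub.
have [p [fp sp]] := sorted_remainder f; suff p0 : p = 0 by rewrite p0 subr0 in fp.
have Ip : p \mPo gens_S K S = 0.
  have := sub _ fp; rewrite /I_S /pi_S comp_mpolyB (If : f \mPo _ = 0) sub0r => /eqP.
  by rewrite oppr_eq0 => /eqP.
apply/eqP/negPn/negP => pn0; have [c cp] : exists c, c \in msupp p.
  by have [c [cp _]] := mo_lead arc_lt_order pn0; exists c.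
have [d [dp dc ed]] := toric_ker_other gE Ip cp.
by case/eqP: dc; apply: sorted_unique ed; apply: sp.
Qed.

(** A sorted leading monomial [c] would have a partner [d] in its fibre. Reduction lowers [d] to the
    only sorted monomial there, which is [c], so [d] would be larger than the leading monomial. *)
Lemma lead_nested f c : I f -> is_initial_mon arc_lt f c ->
  exists x y, nested x y /\ (U_(x) + U_(y) <= c)%MM.
Proof.
move=> If [cf clt]; have [sc|//] := sorted_or_nested c.
have [d [df dc ed]] := toric_ker_other gE If cf.
have [d' [sd' ed' ld' _]] := sorted_reduction d.
have d'c : d' = c by apply: sorted_unique => //; rewrite ed' ed.
have := clt _ df dc; case: ld' => [dd|]; first by rewrite -d'c dd eqxx in dc.
by rewrite d'c => /(mo_tr arc_lt_order) h /h; rewrite (mo_irr arc_lt_order).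
Qed.

Lemma threshold_quadratic_binomials : gen_by_quadratic_binomials I.
Proof.
exists quadrics; split=> [g [x [y [xy ->]]]|f]; last by rewrite quadrics_generate.
split; last exact: swap_binomial_in.
exists (U_(x) + U_(y))%MM, (U_(swap x y) + U_(swap y x))%MM.
by rewrite !mdegD !mdeg1 swap_neq.
Qed.

Lemma nested_initial x y : nested x y -> initial_monomials arc_lt I 'X_[U_(x) + U_(y)].
Proof.
move=> xy; exists (swap_binomial x y), (U_(x) + U_(y))%MM.
by split; [apply: swap_binomial_in | split; [apply: swap_binomial_neq0 | split=> //; apply: swap_binomial_lead]].
Qed.

Lemma initial_ideal_nested (G : P -> Prop) :
  (forall x y, nested x y -> G 'X_[U_(x) + U_(y)]) ->
  (forall g, G g -> initial_ideal arc_lt I g) -> same_set (initial_ideal arc_lt I) (ideal_gen G).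
Proof.
move=> nG GI f; split; last exact: ideal_gen_sub.
apply: ideal_gen_sub => g [p [c [Ip [_ [pc ->]]]]].
have [x [y [xy le]]] := lead_nested Ip pc.
by rewrite -(submK le) mpolyXD; apply: ideal_genM; apply: ideal_gen_in; apply: nG.
Qed.

Lemma threshold_squarefree_initial : has_squarefree_initial_ideal I.
Proof.
exists arc_lt; split; first exact: arc_lt_order.
exists (fun c => exists x y, nested x y /\ c = (U_(x) + U_(y))%MM); split.
  move=> _ [x [y [xy ->]]]; apply/forallP => z; rewrite mnmDE !mnm1E.
  have [xz|_] := eqVneq x z; have [yz|_] := eqVneq y z => //.
  by move: xy; rewrite xz yz nested_irr.
apply: initial_ideal_nested => [x y xy|g [c [[x [y [xy ->]]] ->]]].
  by exists (U_(x) + U_(y))%MM; split=> //; exists x, y.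
by apply: ideal_gen_in; apply: nested_initial.
Qed.

Lemma threshold_quadratic_groebner : has_quadratic_groebner_basis I.
Proof.
exists arc_lt; split; first exact: arc_lt_order.
exists quadrics; split=> [g [x [y [xy ->]]]|].
  by split; [apply: swap_binomial_in | apply: swap_binomial_neq0 | apply: swap_binomial_homog].
apply: initial_ideal_nested => [x y xy|g [p [c [[x [y [xy ->]]] [pn0 [pc ->]]]]]].
  exists (swap_binomial x y), (U_(x) + U_(y))%MM; split; first by exists x, y.
  by split; [apply: swap_binomial_neq0 | split=> //; apply: swap_binomial_lead].
apply: ideal_gen_in; exists (swap_binomial x y), c.
by split; [apply: swap_binomial_in | ].
Qed.

(** Generators of another ring with the same kernel are allowed, because a block diagonal table
    shares its ideal with a threshold table but spans a different subring. *)
Lemma threshold_koszul d (gens : N.-tuple {mpoly K[d]}) :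
  (forall p : P, p \mPo gens = 0 <-> I p) ->
  koszul_ring (fun f => exists p : P, f = p \mPo gens)
    (fun f => exists p : P, p \is 1.-homog /\ f = p \mPo gens)
    (fun f => exists p : P, p@_0%MM = 0 /\ f = p \mPo gens).
Proof.
move=> kerE; apply: (koszul_of_quadratic_initial_ideal arc_lt_order _
  (bad := fun x y => nested x y || nested y x)) => [p /kerE Ip|x y|x y|p c /kerE Ip pc].
(* Zero row margins leave only the monomial 1, which is therefore alone in its fibre. *)
- apply: (toric_ker_singleton gE Ip) => c /same_marginsP[hr _ _ _].
  apply/mnmP => x; rewrite mnm0E; apply/eqP; rewrite -leqn0.
  have -> : 0%N = cnt (0%MM : 'X_{1..N}) [pred y | row y == row x].
    by rewrite /cnt big1 // => y _; rewrite mnm0E.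
  by rewrite -hr /cnt (bigD1 x) //= leq_addr.
- exact: orbC.
- case/orP => xy.
    exists (swap_binomial x y); split; last exact: swap_binomial_lead.
      by apply/kerE; apply: swap_binomial_in.
    exact: swap_binomial_homog.
  exists (swap_binomial y x); split; last by rewrite addmC; apply: swap_binomial_lead.
    by apply/kerE; apply: swap_binomial_in.
  exact: swap_binomial_homog.
have [x [y [xy le]]] := lead_nested Ip pc.
by exists x, y; rewrite xy.
Qed.

End Ideal.
End Threshold.

(** * Normality *)

Lemma cnt_le N (c : 'X_{1..N}) (Q R : pred 'I_N) : subpred Q R -> (cnt c Q <= cnt c R)%N.
Proof.
move=> QR; rewrite (cnt_split c R Q) (eq_cnt c (R := [pred x | R x && Q x])) ?leq_addr //.
by move=> x /=; case Qx: (Q x); rewrite ?andbF // andbT QR.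
Qed.

(** * Tables with prescribed margins and prescribed sum over [S] *)

Section PrefixSums.
Variables (r : nat) (p : 'I_r -> nat).

Definition prefix_sum (z : nat) (V : 'I_r -> nat) : nat := (\sum_(j | p j < z) V j)%N.

Lemma prefix_sum_le z z' V : (z <= z')%N -> (prefix_sum z V <= prefix_sum z' V)%N.
Proof.
move=> zz; rewrite /prefix_sum [X in (_ <= X)%N](bigID (fun j => p j < z)%N) /=.
rewrite [X in (_ <= X + _)%N](eq_bigl (fun j => p j < z)%N) ?leq_addr // => j.
by case: (ltnP (p j) z) => h; rewrite ?andbF // andbT (leq_trans h zz).
Qed.

Lemma prefix_sum_all L V : (forall j, p j < L)%N -> prefix_sum L V = (\sum_j V j)%N.
Proof. by move=> pL; apply: eq_bigl => j; rewrite pL. Qed.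

(** List the units of [V] by position: [j] holds the unit numbered [th], counting from 0. *)
Lemma prefix_sum_cross L V th : (th < prefix_sum L V)%N ->
  exists j, [/\ (0 < V j)%N, (prefix_sum (p j) V <= th)%N & (th < prefix_sum (p j).+1 V)%N].
Proof.
move=> hL; have ex : exists z, (th < prefix_sum z V)%N by exists L.
case: (ex_minnP ex) => -[|z] hz zmin.
  by rewrite /prefix_sum big_pred0 in hz.
have lez : (prefix_sum z V <= th)%N.
  by rewrite leqNgt; apply/negP => /zmin; rewrite ltnn.
have [/existsP[j /andP[/eqP pj Vj]]|nj] := boolP [exists j, (p j == z) && (0 < V j)%N].
  by exists j; rewrite pj.
suff e : prefix_sum z.+1 V = prefix_sum z V by move: hz; rewrite e ltnNge lez.
rewrite /prefix_sum (bigID (fun j => p j < z)%N) /= [X in (_ + X)%N]big1 => [|j /andP[h1 h2]].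
  rewrite addn0; apply: eq_bigl => j; case: (ltnP (p j) z) => h; rewrite ?andbF // andbT.
  exact: ltnW.
apply/eqP; rewrite -leqn0 leqNgt; apply: contra nj => Vj; apply/existsP; exists j.
by rewrite Vj andbT eqn_leq -ltnS h1 leqNgt.
Qed.

Lemma prefix_sum_dec z V j0 : (0 < V j0)%N ->
  prefix_sum z V = (prefix_sum z (fun j => V j - (j0 == j)) + (p j0 < z))%N.
Proof.
move=> V0; have e : prefix_sum z (fun j => (j0 == j) : nat) = (p j0 < z)%N.
  rewrite /prefix_sum; case: ltnP => h.
    rewrite (bigD1 j0) //= eqxx big1 // => j /andP[_ jj].
    by rewrite eq_sym (negbTE jj).
  by rewrite big1 // => j jz; case: eqP => // e; move: jz; rewrite -e ltnNge h.
rewrite -e /prefix_sum -big_split; apply: eq_bigr => j _ /=.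
by case: eqP => [<-|_]; rewrite ?subn0 ?addn0 // subnK.
Qed.

End PrefixSums.

Section Feasibility.
Variables (m n : nat) (Hn : (0 < n)%N) (S : {set 'I_m * 'I_n}).
Variables (a : 'I_m -> nat) (b : 'I_n -> nat) (L : nat).
Hypotheses (aL : forall i, (a i < L)%N) (bL : forall j, (b j < L)%N).
Hypothesis ab : forall i j, a i <> b j.
Hypothesis SE : forall i j, ((i, j) \in S) = (b j < a i)%N.
Local Notation N := (m * n)%N.
Local Notation row := (row_of Hn).
Local Notation col := (col_of Hn).
Local Notation inS := (in_S Hn S).
Local Notation phi := (toric_exp (gen_exp Hn S)).
Local Notation us := (prefix_sum a).
Local Notation vs := (prefix_sum b).

(* The number of arcs through the point [z] is [w + us z U - vs z V]; it must lie
   between 0 and the total number [w + t] of arcs. *)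
Definition feasible (U : 'I_m -> nat) (V : 'I_n -> nat) (w t : nat) : Prop :=
  [/\ us L U = w + t, vs L V = w + t &
      forall z, vs z V <= w + us z U /\ us z U <= t + vs z V]%N.

(** Greedy construction of a sorted table: the cell removed joins the first row unit to the column
    unit at which its arc ends in a sorted table, and the inequalities at all points [z] survive the
    removal. *)
Lemma feasible_table U V w t : feasible U V w t -> exists c : 'X_{1..N},
  [/\ forall i, cnt c [pred x | row x == i] = U i, forall j, cnt c [pred x | col x == j] = V j,
      cnt c inS = w & cnt c (predC inS) = t].
Proof.
have [k] := ubnP (w + t)%N; elim: k U V w t => // k IH U V w t; rewrite ltnS => wtk [uL vL h].
have [wt0|wt0] := posnP (w + t).
  exists 0%MM; have c0 Q : cnt (0%MM : 'X_{1..N}) Q = 0%N by rewrite /cnt big1 // => x _; rewrite mnm0E.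
  split=> [i|j||]; rewrite c0.
  - move: uL; rewrite wt0 (prefix_sum_all _ aL) => /eqP; rewrite sum_nat_eq0.
    by move=> /forallP/(_ i)/eqP.
  - move: vL; rewrite wt0 (prefix_sum_all _ bL) => /eqP; rewrite sum_nat_eq0.
    by move=> /forallP/(_ j)/eqP.
  - by move/eqP: wt0; rewrite addn_eq0 => /andP[/eqP->].
  by move/eqP: wt0; rewrite addn_eq0 => /andP[_ /eqP->].
have [|i [Ui ui1 ui2]] := @prefix_sum_cross _ a L U 0; first by rewrite uL.
(* In a sorted table the last [t] column units end the arcs off [S]. If [t > 0], the first start
   belongs to such an arc, ending at unit number [w]; if [t = 0], it belongs to an arc in [S],
   ending at unit 0. *)
pose th := (if 0 < t then w else 0)%N.
have [|j [Vj vj1 vj2]] := @prefix_sum_cross _ b L V th.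
  by rewrite vL /th; case: ifP; move: wt0; clear; lia.
have um z : (z <= a i)%N -> us z U = 0%N.
  by move=> za; apply/eqP; rewrite -leqn0; apply: leq_trans ui1; apply: prefix_sum_le.
have up z : (a i < z)%N -> (0 < us z U)%N.
  by move=> za; apply: leq_trans ui2 _; apply: prefix_sum_le.
have vm z : (z <= b j)%N -> (vs z V <= th)%N.
  by move=> za; apply: leq_trans vj1; apply: prefix_sum_le.
have vp z : (b j < z)%N -> (th < vs z V)%N.
  by move=> za; apply: leq_trans vj2 _; apply: prefix_sum_le.
have uN z : (us z U <= w + t)%N.
  rewrite -uL (prefix_sum_all _ aL) /prefix_sum [X in (_ <= X)%N](bigID (fun i => a i < z)%N) /=.
  exact: leq_addr.
have vN z : (vs z V <= w + t)%N.
  rewrite -vL (prefix_sum_all _ bL) /prefix_sum [X in (_ <= X)%N](bigID (fun j => b j < z)%N) /=.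
  exact: leq_addr.
pose x := cell_of Hn i j.
have rx : row x = i by apply: cell_ofK1.
have cx : col x = j by apply: cell_ofK2.
have xS : inS x = (b j < a i)%N by rewrite /in_S rx cx SE.
pose U' i' := (U i' - (i == i'))%N; pose V' j' := (V j' - (j == j'))%N.
have uE z : us z U = (us z U' + (a i < z))%N by apply: prefix_sum_dec.
have vE z : vs z V = (vs z V' + (b j < z))%N by apply: prefix_sum_dec.
have abij := @ab i j.
suff [w' [t' [ww tt fe]]] : exists w' t', [/\ w = (w' + inS x)%N, t = (t' + ~~ inS x)%N &
    feasible U' V' w' t'].
  have [|c [cr cc cS cT]] := IH U' V' w' t' _ fe.
    by apply: leq_trans wtk; rewrite ww tt; case: (inS x); clear; lia.
  exists (c + U_(x))%MM; split=> [i'|j'||]; rewrite cntD cnt1 /=.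
  - by rewrite cr rx /U' subnK //; case: eqP => // <-.
  - by rewrite cc cx /V' subnK //; case: eqP => // <-.
  - by rewrite cS.
  by rewrite cT.
rewrite xS; case: (posnP t) => t0; rewrite /th t0 /= in vm vp.
  (* With [t = 0] the inequality at the point just after [a i] requires a column unit before it, so
     the chosen cell lies in [S]. *)
  have ba : (b j < a i)%N.
    have [_] := h (a i).+1; rewrite t0 add0n; have := up _ (ltnSn (a i)).
    by have := vm (a i).+1; move: abij; clear; lia.
  exists w.-1, 0%N; rewrite ba t0 /=; split=> //; first by move: wt0 t0; clear; lia.
  split.
  - by have := uE L; rewrite uL aL t0; move: wt0 t0; clear; lia.
  - by have := vE L; rewrite vL bL t0; move: wt0 t0; clear; lia.
  move=> z; have := h z; have := um z; have := up z; have := vm z; have := vp z.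
  have := uN z; have := vN z.
  by rewrite (uE z) (vE z) t0; move: wt0 t0 ba; clear; lia.
have ba : (a i < b j)%N.
  have [+ _] := h (b j).+1; have := vp _ (ltnSn (b j)).
  by have := um (b j).+1; move: abij; clear; lia.
exists w, t.-1; have -> : (b j < a i)%N = false by move: ba; clear; lia.
split; [by rewrite addn0 | by move: t0; rewrite /=; clear; lia |].
split.
- by have := uE L; rewrite uL aL; move: t0; clear; lia.
- by have := vE L; rewrite vL bL; move: t0; clear; lia.
move=> z; have := h z; have := um z; have := up z; have := vm z; have := vp z.
have := uN z; have := vN z.
by rewrite (uE z) (vE z); move: t0 ba; clear; lia.
Qed.

End Feasibility.

(* Almost integral elements: clearing the denominator [g ^ (d - 1)]. *)
Lemma integral_almost_integral (T : comNzRingType) (R : T -> Prop) (f g : T) d (c : nat -> T) :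
  R 0 -> R 1 -> (forall x y, R x -> R y -> R (x + y)) -> (forall x y, R x -> R y -> R (x * y)) ->
  (forall x, R x -> R (- x)) -> R f -> R g -> (forall k, R (c k)) -> (0 < d)%N ->
  f ^+ d + \sum_(1 <= k < d.+1) c k * f ^+ (d - k) * g ^+ k = 0 ->
  forall n, exists2 h, R h & g ^+ d.-1 * f ^+ n = g ^+ n * h.
Proof.
move=> R0 R1 RD RM RN Rf Rg Rc d0 eqn.
have RX x k : R x -> R (x ^+ k).
  by move=> Rx; elim: k => [|k IH]; [rewrite expr0 | rewrite exprS; apply: RM].
elim/ltn_ind => n IH; have [nd|dn] := ltnP n d.
  exists (g ^+ (d.-1 - n) * f ^+ n); first by apply: RM; apply: RX.
  by rewrite mulrA -exprD; congr (_ ^+ _ * _); move: nd; clear; lia.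
have -> : f ^+ n = - \sum_(1 <= k < d.+1) c k * f ^+ (n - k) * g ^+ k.
  rewrite -[in LHS](subnK dn) exprD; move/eqP: eqn; rewrite addr_eq0 => /eqP ->.
  rewrite mulrN mulr_sumr; congr (- _); rewrite !big_nat; apply: eq_bigr => k /andP[_ kd].
  rewrite (_ : n - k = (n - d) + (d - k))%N ?exprD; last by move: kd dn; clear; lia.
  by ring.
rewrite mulrN mulr_sumr big_nat.
have [h Rh ->] : exists2 h, R h & \sum_(1 <= k < d.+1 | (1 <= k < d.+1)%N)
    g ^+ d.-1 * (c k * f ^+ (n - k) * g ^+ k) = g ^+ n * h.
  apply: (big_ind (fun s => exists2 h, R h & s = g ^+ n * h)).
  - by exists 0; rewrite ?mulr0.
  - by move=> x y [h1 Rh1 ->] [h2 Rh2 ->]; exists (h1 + h2); [apply: RD | rewrite mulrDr].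
  move=> k /andP[k1 kd]; have [|h Rh e] := IH (n - k)%N; first by move: k1 kd dn; clear; lia.
  exists (c k * h); first exact: RM.
  rewrite (_ : g ^+ n = g ^+ (n - k) * g ^+ k); last by rewrite -exprD subnK //; move: kd dn; clear; lia.
  rewrite [LHS](_ : _ = c k * g ^+ k * (g ^+ d.-1 * f ^+ (n - k))); last by ring.
  by rewrite e; ring.
by exists (- h); [apply: RN | rewrite mulrN].
Qed.

(* [Mon] is the set of exponents of a monoid algebra; the last hypothesis says that the
   monoid is completely integrally closed in N^d. *)
Lemma completely_integrally_closed (K : fieldType) d (R : {mpoly K[d]} -> Prop)
    (Mon : 'X_{1..d} -> Prop) :
  R 0 -> (forall x y, R x -> R y -> R (x + y)) -> (forall x y, R x -> R y -> R (x * y)) ->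
  (forall f mu, R f -> mu \in msupp f -> Mon mu) ->
  (forall k mu, Mon mu -> R (k *: 'X_[mu])) ->
  (forall c l, (forall n, Mon (c + l *+ n)%MM) -> Mon l) ->
  forall c f g, c != 0 -> g != 0 -> R c -> R f -> R g ->
  (forall n, exists2 h, R h & c * f ^+ n = g ^+ n * h) -> exists h, R h /\ f = g * h.
Proof.
move=> R0 RD RM Rsupp RX Mclosed c f g c0 g0 Rc + Rg.
elim/mleadrect: f => f IH Rf alm.
have [->|f0] := eqVneq f 0; first by exists 0; rewrite mulr0.
have hn n : exists2 mu, Mon mu & (mlead c + mlead f *+ n = mlead g *+ n + mu)%MM.
  have [h Rh e] := alm n.
  have h0 : h != 0.
    apply/eqP => h0; move/eqP: e; rewrite h0 mulr0 mulf_eq0 (negbTE c0) /= expf_eq0 (negbTE f0).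
    by rewrite andbF.
  exists (mlead h); first by apply: (Rsupp h) => //; apply: mlead_supp.
  by rewrite -!mleadX // -!mleadM ?expf_neq0 // e.
(* A deficit of [mlead f] in the variable [i] would be multiplied by [n], while [mlead c] can make
   up at most [mlead c i]. *)
have gf : (mlead g <= mlead f)%MM.
  apply/mnm_lepP => i; have [mu _ /mnmP/(_ i)] := hn (mlead c i).+1.
  by rewrite !mnmDE !mulmnE; clear; nia.
pose l := (mlead f - mlead g)%MM.
have fl : mlead f = (l + mlead g)%MM by rewrite /l submK.
have Ml : Mon l.
  apply: (Mclosed (mlead c)) => n; have [mu Mmu e] := hn n.
  rewrite (_ : _ + _ = mu)%MM //; move: e; rewrite fl => /mnmP e; apply/mnmP => i.
  by have := e i; rewrite !mnmDE !mulmnE mnmDE; clear; nia.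
pose s := (mleadc f / mleadc g) *: 'X_[l].
have Rs : R s by apply: RX.
have cg0 : mleadc g != 0 by rewrite mleadc_eq0.
have Rsg : R (f - s * g).
  apply: RD => //; rewrite -mulNr; apply: RM => //.
  by rewrite /s -scaleNr; apply: RX.
(* In the binomial expansion [c * f ^+ (n - i)] supplies [g ^+ (n - i)] and [(s * g) ^+ i] supplies
   the missing [g ^+ i]. *)
have alm' n : exists2 h, R h & c * (f - s * g) ^+ n = g ^+ n * h.
  rewrite exprBn mulr_sumr.
  apply: (big_ind (fun x => exists2 h, R h & x = g ^+ n * h)).
  - by exists 0; rewrite ?mulr0.
  - by move=> x y [h1 Rh1 ->] [h2 Rh2 ->]; exists (h1 + h2); [apply: RD | rewrite mulrDr].
  move=> i _; have [h Rh e] := alm (n - i)%N.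
  have in' : (i <= n)%N by rewrite -ltnS.
  exists (((-1) ^+ i * 'C(n, i)%:R) *: (h * s ^+ i)).
    have -> (k : K) x : k *: x = (k *: 'X_[0%MM]) * x by rewrite -scalerAl mpolyX0 mul1r.
    have M0 : Mon 0%MM by apply: (Mclosed (mlead g)) => n'; rewrite (_ : _ + _ = mlead g)%MM;
      [apply: (Rsupp g) => //; apply: mlead_supp | apply/mnmP => j; rewrite mnmDE mulmnE mnm0E; lia].
    have R1 k : R (k *: 'X_[0%MM]) by apply: RX.
    have RsX k : R (s ^+ k).
      elim: k => [|k IHk]; last by rewrite exprS; apply: RM.
      by rewrite expr0 -mpolyX0 -[X in R X]scale1r.
    by apply: (RM _ _ (R1 _)); apply: RM.
  rewrite (_ : g ^+ n = g ^+ (n - i) * g ^+ i); last by rewrite -exprD subnK.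
  rewrite -scalerAr exprMn -mulr_natr.
  rewrite (_ : c * _ = (-1) ^+ i * 'C(n, i)%:R * (c * f ^+ (n - i)) * (s ^+ i * g ^+ i)); last by ring.
  rewrite e -mul_mpolyC rmorphM rmorphXn rmorphN1 /= rmorph_nat; ring.
have lt : f - s * g != 0 -> (mlead (f - s * g) < mlead f)%O.
  move=> r0; have lsg : mlead (s * g) = mlead f.
    have X0 : 'X_[K, l] != 0.
      by apply/eqP => /(congr1 (mcoeff l)); rewrite mcoeffX eqxx mcoeff0 => /eqP; rewrite oner_eq0.
    have cf0 : mleadc f != 0 by rewrite mleadc_eq0.
    have k0 : mleadc f / mleadc g != 0 by rewrite mulf_neq0 ?invr_eq0.
    by rewrite /s -scalerAl (mleadZ _ k0) (mleadM X0 g0) mleadXm -fl.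
  have le : (mlead (f - s * g) <= mlead f)%O.
    by apply: le_trans (mleadB_le _ _) _; rewrite lsg joinxx.
  rewrite lt_neqAle le andbT; apply/eqP => e.
  have := mlead_supp r0; rewrite e mcoeff_msupp mcoeffB /s -scalerAl mcoeffZ.
  have -> : ('X_[l] * g)@_(mlead f) = mleadc g by rewrite fl mcoeffXM.
  by rewrite divfK // subrr eqxx.
have [r0|r0] := eqVneq (f - s * g) 0.
  by exists s; split=> //; rewrite mulrC; apply/eqP; rewrite -subr_eq0 r0.
have [h [Rh e]] := IH _ (lt r0) Rsg alm'.
exists (h + s); split; first exact: RD.
by rewrite mulrDr -e [g * s]mulrC subrK.
Qed.

(** An integral equation says that a polynomial expression in chosen preimages lies in the kernel,
    so equal kernels transport it, and the resulting quotient as well. *)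
Lemma normal_subring_kernel (K : fieldType) N d d' (gens : N.-tuple {mpoly K[d]})
    (gens' : N.-tuple {mpoly K[d']}) :
  (forall p : {mpoly K[N]}, p \mPo gens = 0 <-> p \mPo gens' = 0) ->
  normal_subring (fun f => exists p : {mpoly K[N]}, f = p \mPo gens') ->
  normal_subring (fun f => exists p : {mpoly K[N]}, f = p \mPo gens).
Proof.
move=> kerE nor f g [p ->] [q ->] q0 [k [c [k0 [Rc eqn]]]].
pose c' i := proj1_sig (constructive_indefinite_description _ (Rc i)).
have cE i : c i = c' i \mPo gens by rewrite /c'; case: (constructive_indefinite_description _ _).
have eqE (d0 : nat) (G : N.-tuple {mpoly K[d0]}) :
    (p \mPo G) ^+ k + \sum_(1 <= i < k.+1) (c' i \mPo G) * (p \mPo G) ^+ (k - i) * (q \mPo G) ^+ i =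
    (p ^+ k + \sum_(1 <= i < k.+1) c' i * p ^+ (k - i) * q ^+ i) \mPo G.
  rewrite rmorphD rmorphXn rmorph_sum /=; congr (_ + _); apply: eq_bigr => i _.
  by rewrite !rmorphM !rmorphXn.
have [||h [[r ->] e]] := nor (p \mPo gens') (q \mPo gens') (ex_intro _ p erefl) (ex_intro _ q erefl).
- by apply: contra q0 => /eqP/kerE->.
- exists k, (fun i => c' i \mPo gens'); split=> //; split; first by move=> i; exists (c' i).
  rewrite eqE; apply/kerE; rewrite -eqE -[RHS]eqn; congr (_ + _).
  by apply: eq_bigr => i _; rewrite cE.
exists (r \mPo gens); split; first by exists r.
apply/eqP; rewrite -subr_eq0 -rmorphM -rmorphB; apply/eqP/kerE.
by rewrite rmorphB rmorphM /= e subrr.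
Qed.

Section ThresholdNormal.
Variables (m n : nat) (Hn : (0 < n)%N) (S : {set 'I_m * 'I_n}).
Variables (a : 'I_m -> nat) (b : 'I_n -> nat) (L : nat).
Hypotheses (aL : forall i, (a i < L)%N) (bL : forall j, (b j < L)%N).
Hypothesis ab : forall i j, a i <> b j.
Hypothesis SE : forall i j, ((i, j) \in S) = (b j < a i)%N.
Local Notation phi := (toric_exp (gen_exp Hn S)).

Definition feasible_exp (mu : 'X_{1..(m + n).+2}) : Prop :=
  feasible a b L (fun i => mu (u_var n i)) (fun j => mu (v_var m j)) (mu (w_var m n)) (mu (t_var m n)).

Lemma feasible_expP mu : feasible_exp mu <-> exists c, phi c = mu.
Proof.
split=> [/(feasible_table Hn aL bL ab SE)[c [cr cc cS cT]]|[c <-]].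
  exists c; apply/mnmP => k; case: (amb_var_cases Hn k) => [[i ->]|[j ->]|->|->].
  - by rewrite toric_u.
  - by rewrite toric_v.
  - by rewrite toric_w.
  by rewrite toric_t.
have us z : prefix_sum a z (fun i => phi c (u_var n i)) = cnt c [pred x | (a (row_of Hn x) < z)%N].
  rewrite (cnt_fiber c (row_of Hn) (fun i => (a i < z)%N)); apply: eq_bigr => i _.
  exact: toric_u.
have vs z : prefix_sum b z (fun j => phi c (v_var m j)) = cnt c [pred x | (b (col_of Hn x) < z)%N].
  rewrite (cnt_fiber c (col_of Hn) (fun j => (b j < z)%N)); apply: eq_bigr => j _.
  exact: toric_v.
have tot (Q : pred 'I_(m * n)) : (forall x, Q x) -> cnt c Q = (cnt c (in_S Hn S) + cnt c (predC (in_S Hn S)))%N.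
  move=> hQ; rewrite (cnt_split c Q (in_S Hn S)).
  by congr (_ + _)%N; apply: eq_cnt => x /=; rewrite hQ.
rewrite /feasible_exp /feasible !us !vs !toric_w !toric_t; split.
- by apply: tot => x; rewrite /= aL.
- by apply: tot => x; rewrite /= bL.
(* A cell with its column before [z] and its row at or after [z] is in [S]; with the roles of row
   and column exchanged it is off [S]. *)
move=> z; rewrite us vs; split.
- rewrite (cnt_split c _ [pred x | (a (row_of Hn x) < z)%N]) addnC; apply: leq_add.
    apply: cnt_le => x /= /andP[h1 h2]; rewrite /in_S SE.
    by move: h1 h2; clear; lia.
  by apply: cnt_le => x /= /andP[].
rewrite (cnt_split c _ [pred x | (b (col_of Hn x) < z)%N]) addnC; apply: leq_add.
  apply: cnt_le => x /= /andP[h1 h2]; rewrite /in_S SE.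
  by move: h1 h2; clear; lia.
by apply: cnt_le => x /= /andP[].
Qed.

(** Feasibility is a system of homogeneous linear equations and inequalities; along [c + l *+ k] the
    multiple of [l] dominates for large [k]. *)
Lemma feasible_exp_closed c l : (forall k, feasible_exp (c + l *+ k)%MM) -> feasible_exp l.
Proof.
move=> h.
have us z k : prefix_sum a z (fun i => (c + l *+ k)%MM (u_var n i)) =
    (prefix_sum a z (fun i => c (u_var n i)) + prefix_sum a z (fun i => l (u_var n i)) * k)%N.
  rewrite /prefix_sum big_distrl -big_split; apply: eq_bigr => i _ /=.
  by rewrite mnmDE mulmnE.
have vs z k : prefix_sum b z (fun j => (c + l *+ k)%MM (v_var m j)) =
    (prefix_sum b z (fun j => c (v_var m j)) + prefix_sum b z (fun j => l (v_var m j)) * k)%N.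
  rewrite /prefix_sum big_distrl -big_split; apply: eq_bigr => j _ /=.
  by rewrite mnmDE mulmnE.
have eq_lim (x y x' y' : nat) : (forall k, x + y * k = x' + y' * k)%N -> y = y'.
  by move=> e; have := e 0%N; have := e 1%N; clear; lia.
have le_lim (x y x' y' : nat) : (forall k, x + y * k <= x' + y' * k)%N -> (y <= y')%N.
  by move=> e; have := e x'.+1; clear; nia.
split.
- apply: (eq_lim (prefix_sum a L (fun i => c (u_var n i))) _ (c (w_var m n) + c (t_var m n))%N) => k.
  have [e _ _] := h k; rewrite us in e; rewrite e !mnmDE !mulmnE; clear; nia.
- apply: (eq_lim (prefix_sum b L (fun j => c (v_var m j))) _ (c (w_var m n) + c (t_var m n))%N) => k.
  have [_ e _] := h k; rewrite vs in e; rewrite e !mnmDE !mulmnE; clear; nia.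
move=> z; split.
- apply: (le_lim (prefix_sum b z (fun j => c (v_var m j))) _
    (c (w_var m n) + prefix_sum a z (fun i => c (u_var n i)))%N) => k.
  have [_ _ /(_ z)[e _]] := h k; move: e; rewrite us vs !mnmDE !mulmnE; clear; nia.
apply: (le_lim (prefix_sum a z (fun i => c (u_var n i))) _
    (c (t_var m n) + prefix_sum b z (fun j => c (v_var m j)))%N) => k.
have [_ _ /(_ z)[_ e]] := h k; move: e; rewrite us vs !mnmDE !mulmnE; clear; nia.
Qed.

Lemma threshold_normal (K : fieldType) : normal_subring (R_S (K:=K) S).
Proof.
pose gE := gens_SE Hn S K.
have R0 : R_S (K:=K) S 0 by exists 0; rewrite /pi_S comp_mpoly0.
have R1 : R_S (K:=K) S 1 by exists 1; rewrite /pi_S comp_mpoly1.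
have RD x y : R_S (K:=K) S x -> R_S (K:=K) S y -> R_S (K:=K) S (x + y).
  by move=> [p ->] [q ->]; exists (p + q); rewrite /pi_S comp_mpolyD.
have RM x y : R_S (K:=K) S x -> R_S (K:=K) S y -> R_S (K:=K) S (x * y).
  by move=> [p ->] [q ->]; exists (p * q); rewrite /pi_S rmorphM.
have RN x : R_S (K:=K) S x -> R_S (K:=K) S (- x).
  by move=> [p ->]; exists (- p); rewrite /pi_S comp_mpolyN.
have Rsupp f mu : R_S (K:=K) S f -> mu \in msupp f -> feasible_exp mu.
  move=> [p ->]; rewrite mcoeff_msupp /pi_S (mcoeff_toric gE) => h; apply/feasible_expP.
  have [/hasP[c _ /eqP <-]|nh] := boolP (has (fun c => phi c == mu) (msupp p)); first by exists c.
  by rewrite big_hasC ?eqxx in h.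
have RX k mu : feasible_exp mu -> R_S (K:=K) S (k *: 'X_[mu]).
  by move=> /feasible_expP[c <-]; exists (k *: 'X_[c]); rewrite /pi_S comp_mpolyZ (comp_toricX gE).
move=> f g Rf Rg g0 [k [c [k0 [Rc eqn]]]].
have alm := integral_almost_integral R0 R1 RD RM RN Rf Rg Rc k0 eqn.
have Rgk : R_S (K:=K) S (g ^+ k.-1).
  by elim: k.-1 => [|i IH]; [rewrite expr0 | rewrite exprS; apply: RM].
have gk0 : g ^+ k.-1 != 0 by rewrite expf_neq0.
exact: (completely_integrally_closed R0 RD RM Rsupp RX feasible_exp_closed gk0 g0 Rgk Rf Rg alm).
Qed.

End ThresholdNormal.

(** * The two shapes *)

Definition all_conditions_hold (K : fieldType) m n (S : {set 'I_m * 'I_n}) : Prop :=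
  [/\ gen_by_quadratic_binomials (I_S (K:=K) S),
      has_squarefree_initial_ideal (I_S (K:=K) S),
      has_quadratic_groebner_basis (I_S (K:=K) S),
      normal_subring (R_S (K:=K) S) &
      koszul_ring (R_S (K:=K) S) (R_S1 (K:=K) S) (R_Splus (K:=K) S)].

Lemma same_setT (K : fieldType) N (A B B' : {mpoly K[N]} -> Prop) :
  (forall p, B p <-> B' p) -> same_set A B -> same_set A B'.
Proof. by move=> BB h p; rewrite h. Qed.

Lemma initial_ideal_ext (K : fieldType) N (lt : rel 'X_{1..N}) (A B : {mpoly K[N]} -> Prop) :
  (forall p, A p <-> B p) -> forall p, initial_ideal lt A p <-> initial_ideal lt B p.
Proof.
have sub (C D : {mpoly K[N]} -> Prop) : (forall p, C p -> D p) -> forall p,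
    initial_ideal lt C p -> initial_ideal lt D p.
  move=> CD p; apply: ideal_gen_sub => q [f [c [Cf h]]]; apply: ideal_gen_in.
  by exists f, c; split=> //; apply: CD.
by move=> AB p; split; apply: sub => q /AB.
Qed.

Lemma levels_conditions_hold (K : fieldType) m n (Hn : (0 < n)%N) (S S' : {set 'I_m * 'I_n})
    (al : 'I_m -> nat) (be : 'I_n -> nat) :
  (forall i j, ((i, j) \in S') = (be j < al i)%N) ->
  (forall c d, toric_exp (gen_exp Hn S) c = toric_exp (gen_exp Hn S) d <->
     toric_exp (gen_exp Hn S') c = toric_exp (gen_exp Hn S') d) ->
  all_conditions_hold K S.
Proof.
move=> SE fib.
have kerE (p : {mpoly K[m * n]}) : p \mPo gens_S K S = 0 <-> p \mPo gens_S K S' = 0.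
  by split; apply: (toric_ker_fibers (gens_SE Hn _ K) (gens_SE Hn _ K)) => c d /fib.
have IE p : I_S (K:=K) S' p <-> I_S (K:=K) S p by split=> /kerE.
(* Perturb the levels so that all rows and columns become distinct points. *)
pose Q := (m + n)%N.
pose a (i : 'I_m) := (2 * al i * Q + i)%N; pose b (j : 'I_n) := ((2 * be j + 1) * Q + j)%N.
have iQ (i : 'I_m) : (i < Q)%N by apply: ltn_addr.
have jQ (j : 'I_n) : (j < Q)%N by rewrite /Q addnC ltn_addr.
have a_inj : injective a.
  move=> i i' /(congr1 (modn^~ Q)); rewrite /a !modnMDl !modn_small // => e.
  exact: val_inj.
have b_inj : injective b.
  move=> j j' /(congr1 (modn^~ Q)); rewrite /b !modnMDl !modn_small // => e.
  exact: val_inj.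
have aQ i : (a i %/ Q = 2 * al i)%N.
  by rewrite /a divnMDl ?divn_small ?addn0 //; apply: leq_ltn_trans (iQ i).
have bQ j : (b j %/ Q = 2 * be j + 1)%N.
  by rewrite /b divnMDl ?divn_small ?addn0 //; apply: leq_ltn_trans (jQ j).
have ab i j : a i <> b j.
  by move/(congr1 (divn^~ Q)); rewrite aQ bQ; clear; lia.
(* Rows lie in even and columns in odd blocks of length [Q]: [be j < al i] amounts to
   [2 * be j + 1 < 2 * al i], and a tie puts the column after the row, outside [S']. *)
have SE' i j : ((i, j) \in S') = (b j < a i)%N.
  rewrite SE; apply/idP/idP => [h|/ltnW/(leq_div2r Q)]; last by rewrite aQ bQ; clear; lia.
  by rewrite /a /b; have := jQ j; move: h; clear; nia.
pose L := (\sum_i a i + \sum_j b j).+1.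
have aL i : (a i < L)%N by rewrite /L (bigD1 i) //= -addnA ltnS leq_addr.
have bL j : (b j < L)%N by rewrite /L (bigD1 j) //= addnCA ltnS leq_addr.
split.
- have [G [GI GE]] := threshold_quadratic_binomials Hn a_inj b_inj aL bL ab SE' K.
  exists G; split; first by move=> g /GI[gq /IE].
  exact: same_setT GE.
- have [lt [ltO [A [Asq AE]]]] := threshold_squarefree_initial Hn a_inj b_inj aL bL ab SE' K.
  exists lt; split=> //; exists A; split=> // p.
  exact: iff_trans (iff_sym (initial_ideal_ext lt IE p)) (AE p).
- have [lt [ltO [G [GI GE]]]] := threshold_quadratic_groebner Hn a_inj b_inj aL bL ab SE' K.
  exists lt; split=> //; exists G; split; first by move=> g /GI[/IE].
  by move=> p; exact: iff_trans (iff_sym (initial_ideal_ext lt IE p)) (GE p).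
- by apply: (normal_subring_kernel kerE); apply: (threshold_normal Hn aL bL ab SE').
by apply: (threshold_koszul Hn a_inj b_inj aL bL ab SE') => p; apply: kerE.
Qed.

Lemma card_perm_lt r (s : 'S_r) k : (k <= r)%N -> #|[set j | (s j < k)%N]| = k.
Proof.
move=> kr; have {2}-> : k = (\sum_(i < k) 1)%N by rewrite big_const_ord iter_addn addn0 mul1n.
rewrite (big_ord_widen _ (fun=> 1%N) kr) (reindex_inj (@perm_inj _ s)) -sum1_card.
by apply: eq_bigl => j; rewrite inE.
Qed.

(** In the column order [s'] every row of [S] is an initial segment, so its cardinality is the
    threshold. *)
Lemma triangular_levels m n (S : {set 'I_m * 'I_n}) : triangular S ->
  exists al be, forall i j, ((i, j) \in S) = (be j < al i)%N.
Proof.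
move=> [s [s' tri]].
exists (fun i => #|[set j | (i, j) \in S]|), (fun j => s' j : nat) => i j.
have down j' : (i, j) \in S -> (s' j' <= s' j)%N -> (i, j') \in S by move=> h; apply: tri h _.
have [ij|ij] := boolP ((i, j) \in S).
  apply/esym; rewrite -[X in (X <= _)%N](card_perm_lt s') //; apply: subset_leq_card.
  by apply/subsetP => j'; rewrite !inE ltnS; apply: down.
apply/esym/negbTE; rewrite -leqNgt -[X in (_ <= X)%N](card_perm_lt s' (ltnW (ltn_ord (s' j)))).
apply: subset_leq_card; apply/subsetP => j'; rewrite !inE => ij'.
by rewrite ltnNge; apply: contra ij => h; apply: tri ij' _ h.
Qed.

(* With fixed margins, the sum over a block diagonal [S] determines and is determined
   by the sum over the off-diagonal block [S'], because w + 2 w' is a sum of margins. *)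
Lemma block_diagonal_levels m n (Hn : (0 < n)%N) (S : {set 'I_m * 'I_n}) : block_diagonal_2x2 S ->
  exists (S' : {set 'I_m * 'I_n}) (al : 'I_m -> nat) (be : 'I_n -> nat),
    (forall i j, ((i, j) \in S') = (be j < al i)%N) /\
    forall c d, toric_exp (gen_exp Hn S) c = toric_exp (gen_exp Hn S) d <->
      toric_exp (gen_exp Hn S') c = toric_exp (gen_exp Hn S') d.
Proof.
move=> [s [s' [r [k blk]]]].
pose S' := [set x : 'I_m * 'I_n | (r <= s x.1)%N && (s' x.2 < k)%N].
exists S', (fun i => (r <= s i : nat)%N), (fun j => (k <= s' j : nat)%N); split.
  by move=> i j; rewrite inE /= ltnNge; case: (r <= s i)%N; case: (k <= s' j)%N.
pose Rr (x : 'I_(m * n)) := (r <= s (row_of Hn x))%N.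
pose C (x : 'I_(m * n)) := (s' (col_of Hn x) < k)%N.
have inSE x : in_S Hn S x = (Rr x (+) C x).
  rewrite /in_S /Rr /C; apply/idP/idP => [/blk|h]; [|apply/blk; move: h];
    by case: (ltnP (s _) r); case: (ltnP (s' _) k) => //=; tauto.
have inSE' x : in_S Hn S' x = Rr x && C x by rewrite /in_S inE.
have key (c : 'X_{1..m * n}) : (cnt c (in_S Hn S) + 2 * cnt c (in_S Hn S') = cnt c Rr + cnt c C)%N.
  rewrite (cnt_split c (in_S Hn S) Rr) (cnt_split c Rr C) (cnt_split c C Rr).
  have -> : cnt c [pred x | in_S Hn S x && Rr x] = cnt c [pred x | Rr x && ~~ C x].
    by apply: eq_cnt => x /=; rewrite inSE; case: (Rr x); case: (C x).
  have -> : cnt c [pred x | in_S Hn S x && ~~ Rr x] = cnt c [pred x | C x && ~~ Rr x].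
    by apply: eq_cnt => x /=; rewrite inSE; case: (Rr x); case: (C x).
  have -> : cnt c (in_S Hn S') = cnt c [pred x | Rr x && C x] by apply: eq_cnt.
  have -> : cnt c [pred x | C x && Rr x] = cnt c [pred x | Rr x && C x].
    by apply: eq_cnt => x /=; rewrite andbC.
  by clear; lia.
have rowE (c : 'X_{1..m * n}) : cnt c Rr = (\sum_(i | (r <= s i)%N) cnt c [pred x | row_of Hn x == i])%N.
  exact: (cnt_fiber c (row_of Hn) (fun i => r <= s i)%N).
have colE (c : 'X_{1..m * n}) : cnt c C = (\sum_(j | (s' j < k)%N) cnt c [pred x | col_of Hn x == j])%N.
  exact: (cnt_fiber c (col_of Hn) (fun j => s' j < k)%N).
have totE (c : 'X_{1..m * n}) T : (cnt c T + cnt c (predC T) =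
    \sum_(i : 'I_m) cnt c [pred x | row_of Hn x == i])%N.
  rewrite -(cnt_fiber c (row_of Hn) predT) [RHS](cnt_split c _ T).
  by congr (_ + _)%N; apply: eq_cnt.
move=> c d; split=> /same_marginsP[hr hc hS hT]; apply/same_marginsP.
  have eR : cnt c Rr = cnt d Rr by rewrite !rowE; apply: eq_bigr => i _.
  have eC : cnt c C = cnt d C by rewrite !colE; apply: eq_bigr => j _.
  have eS : cnt c (in_S Hn S') = cnt d (in_S Hn S').
    by have := key c; have := key d; rewrite eR eC hS; clear; lia.
  split=> //; have := totE c (in_S Hn S'); rewrite eS (eq_bigr _ (fun i _ => hr i)).
  by rewrite -(totE d (in_S Hn S')) => /addnI.
have eR : cnt c Rr = cnt d Rr by rewrite !rowE; apply: eq_bigr => i _.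
have eC : cnt c C = cnt d C by rewrite !colE; apply: eq_bigr => j _.
have eS : cnt c (in_S Hn S) = cnt d (in_S Hn S).
  by have := key c; have := key d; rewrite eR eC hS; clear; lia.
split=> //; have := totE c (in_S Hn S); rewrite eS (eq_bigr _ (fun i _ => hr i)).
by rewrite -(totE d (in_S Hn S)) => /addnI.
Qed.

Lemma shape_conditions_hold (K : fieldType) m n (Hn : (0 < n)%N) (S : {set 'I_m * 'I_n}) :
  block_diagonal_2x2 S \/ triangular S -> all_conditions_hold K S.
Proof.
case=> [/(block_diagonal_levels Hn)[S' [al [be [SE fib]]]]|/triangular_levels[al [be SE]]].
  exact: levels_conditions_hold SE fib.
exact: (levels_conditions_hold (Hn := Hn) K SE).
Qed.

(** * Complement, transposition and the final dichotomy *)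

Lemma same_margins_predC N (A B : eqType) (row : 'I_N -> A) (col : 'I_N -> B) (s : pred 'I_N) a b :
  same_margins row col s a b <-> same_margins row col (predC s) a b.
Proof.
have e (c : 'X_{1..N}) : cnt c (predC (predC s)) = cnt c s.
  by apply: eq_cnt => x /=; rewrite negbK.
by rewrite /same_margins !e; split=> -[].
Qed.

Lemma same_margins_tr N (A B : eqType) (row : 'I_N -> A) (col : 'I_N -> B) (s : pred 'I_N) a b :
  same_margins row col s a b <-> same_margins col row s a b.
Proof. by split=> -[]. Qed.

Lemma shape_or_fail (K : fieldType) m n (Hn : (0 < n)%N) (S : {set 'I_m * 'I_n}) :
  (block_diagonal_2x2 S \/ triangular S) \/ all_conditions_fail K S.
Proof.
have sE i j : in_S Hn S (cell_of Hn i j) = ((i, j) \in S) by rewrite /in_S cell_ofK1 cell_ofK2.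
have fib := same_marginsP Hn S.
have fibC c d := iff_trans (fib c d) (same_margins_predC _ _ _ c d).
have fibT c d := iff_trans (fib c d) (same_margins_tr _ _ _ c d).
have fibTC c d := iff_trans (fibT c d) (same_margins_predC _ _ _ c d).
have K1 := @cell_ofK1 m n Hn; have K2 := @cell_ofK2 m n Hn; have K3 := @row_col_ofK m n Hn.
case: (pattern_or_shape S) => [h|h|h|h]; [right; move: h|right; move: h|by left; left|by left; right].
  move=> [i [k [j [l [p [ij il kj kl ip]]]]]]; case kp : ((k, p) \in S); rewrite kp in ip.
    (* If the third column lies in [S] on both rows, the pattern occurs in the complement with [j]
       and [l] exchanged. *)
    apply: (@pattern_fails K _ _ Hn S _ _ _ _ (cell_of Hn) _ i k l j p fibC K1 K2 K3);
      by rewrite /= !sE ?negbK ?ij ?kl ?(negbTE il) ?(negbTE kj) ?ip ?kp.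
  apply: (@pattern_fails K _ _ Hn S _ _ _ _ (cell_of Hn) _ i k j l p fib K1 K2 K3);
    by rewrite /= !sE ?negbK ?ij ?kl ?(negbTE il) ?(negbTE kj) ?ip ?kp.
move=> [i [k [p [j [l [ij il kj kl pj]]]]]]; case pl : ((p, l) \in S); rewrite pl in pj.
  apply: (@pattern_fails K _ _ Hn S _ _ _ _ (fun j i => cell_of Hn i j) _ j l k i p fibTC
    (fun x y => K2 y x) (fun x y => K1 y x) K3);
    by rewrite /= !sE ?negbK ?ij ?kl ?(negbTE il) ?(negbTE kj) ?pj ?pl.
apply: (@pattern_fails K _ _ Hn S _ _ _ _ (fun j i => cell_of Hn i j) _ j l i k p fibT
  (fun x y => K2 y x) (fun x y => K1 y x) K3);
  by rewrite /= !sE ?negbK ?ij ?kl ?(negbTE il) ?(negbTE kj) ?pj ?pl.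
Qed.

Theorem mainTheorem1 (K : fieldType) (m n : nat) (Hm : (0 < m)%N) (Hn : (0 < n)%N)
    (S : {set 'I_m * 'I_n}) :
  let I := I_S (K:=K) S in
  let R := R_S (K:=K) S in
  [/\ (gen_by_quadratic_binomials I <-> has_squarefree_initial_ideal I),
      (has_squarefree_initial_ideal I <-> has_quadratic_groebner_basis I),
      (has_quadratic_groebner_basis I <-> normal_subring R),
      (normal_subring R <-> koszul_ring R (R_S1 (K:=K) S) (R_Splus (K:=K) S)) &
      (koszul_ring R (R_S1 (K:=K) S) (R_Splus (K:=K) S) <-> (block_diagonal_2x2 S \/ triangular S))].
Proof.
move=> I R; have [sh|[f1 f2 f3 f4 f5]] := shape_or_fail K Hn S.
  by have [h1 h2 h3 h4 h5] := shape_conditions_hold K Hn sh.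
have nsh : ~ (block_diagonal_2x2 S \/ triangular S).
  by move=> /(shape_conditions_hold K Hn)[/f1].
by split; tauto.
Qed.
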